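(* Let $n\ge 2$ and let $w^n_\circ=s_{j_1}\cdots s_{j_{n(n-1)/2}}$ be any reduced expression of the longest element $w_\circ^n$ of the symmetric group $S_n$. Then the flows of the corresponding Kogan--Zelevinsky Hamiltonians $H_1,\ldots,H_{n(n-1)/2}$ are complete on $(M_n,\pi_n)$ (their integral curves are defined over all of $\mathbb{C}$). As a consequence, from each such reduced expression one obtains an analytic Hamiltonian action of $\mathbb{C}^{n(n-1)/2}$ on $(M_n,\pi_n)$, in which the $k$-th coordinate subgroup $\mathbb{C}$ acts by the flow of $H_k$.
   Context: $M_n$ is the space of complex $n\times n$ matrices with coordinate functions $x_{ij}$, equipped with the quadratic Poisson structure $$\pi_n=\sum_{i,k=1}^n\sum_{j,l=1}^n(\mathrm{sign}(k-i)+\mathrm{sign}(l-j))\,x_{il}x_{kj}\,\frac{\partial}{\partial x_{ij}}\wedge\frac{\partial}{\partial x_{kl}},$$ where $\mathrm{sign}(a)=1,0,-1$ according to $a>0$, $a=0$, $a<0$; the bracket is normalized by $\{x_{ij},x_{kl}\}=(\mathrm{sign}(k-i)+\mathrm{sign}(l-j))x_{il}x_{kj}$. For index sets $I,J$ with $|I|=|J|$, $\Delta_{I,J}(X)$ is the determinant of the submatrix of $X$ with rows $I$ and columns $J$; $[a,b]=\{a,a+1,\ldots,b\}$. Let $s_1,\ldots,s_{n-1}$ be the simple reflections (adjacent transpositions) in $S_n$; products are compositions of permutations. Given the reduced expression $w^n_\circ=s_{j_1}\cdots s_{j_{n(n-1)/2}}$, for $k=1,\ldots,n(n-1)/2$ set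 $$v_k=s_{j_1}\cdots s_{j_{k-1}},\qquad u_k=(w^n_\circ)^{-1}v_k=s_{j_{n(n-1)/2}}\cdots s_{j_k},$$ and define the Kogan--Zelevinsky Hamiltonians $H_k=\Delta_{u_k[1,j_k],\,v_k[1,j_k]}\in\mathbb{C}[M_n]$, where $u[1,j]$ denotes the image of the set $[1,j]$ under $u\in S_n$. The flow of $H$ is given by the holomorphic (complex time) solutions of $x_{ij}'(t)=\{x_{ij},H\}(X(t))$. An action of $\mathbb{C}^{N}$ on $(M_n,\pi_n)$ is Hamiltonian if it is generated by the Hamiltonian vector fields of $N$ pairwise Poisson commuting functions. *)

(* Defs.v *)
From HB Require Import structures.
From mathcomp Require Import all_boot all_order all_algebra all_fingroup.
From mathcomp Require Import all_classical all_reals all_analysis.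
From mathcomp Require Import complex.

Set Implicit Arguments.
Unset Strict Implicit.
Unset Printing Implicit Defensive.

Import Order.TTheory GRing.Theory Num.Theory.
Import numFieldNormedType.Exports.

Local Open Scope ring_scope.

(* Viewed as a numFieldType, R[i] carries the topology and norm that
   MathComp-Analysis puts on every numFieldType, so that derivatives over
   [Cplx R] are complex derivatives. *)
Definition Cplx (R : realType) : numFieldType := R[i].

(* Rows, columns and letters are numbered from 0: the letter j : 'I_n.-1 stands
   for the classical s_(j+1), and [initial_set j] for the classical [1, j+1]. *)

Lemma simple_refl_subproof1 (n : nat) (j : 'I_n.-1) : (j < n)%N.
Proof. by case: n j => [|n] j; [case: j | exact: ltnW (ltn_ord j)]. Qed.

Lemma simple_refl_subproof2 (n : nat) (j : 'I_n.-1) : (j.+1 < n)%N.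
Proof. by case: n j => [|n] j; [case: j | exact: ltn_ord j]. Qed.

Definition simple_refl (n : nat) (j : 'I_n.-1) : 'S_n :=
  tperm (Ordinal (simple_refl_subproof1 j)) (Ordinal (simple_refl_subproof2 j)).

(* The composition s_{j_1} o ... o s_{j_m}.  The word is reversed because in
   'S_n the product s * t is "first s, then t". *)
Definition word_perm (n : nat) (js : seq 'I_n.-1) : 'S_n :=
  (\prod_(j <- rev js) simple_refl j)%g.

Definition reduced (n : nat) (js : seq 'I_n.-1) : Prop :=
  forall js' : seq 'I_n.-1, word_perm js' = word_perm js ->
    (size js <= size js')%N.

Definition longest (n : nat) (w : 'S_n) : Prop :=
  forall js js' : seq 'I_n.-1, reduced js -> reduced js' ->
    word_perm js = w -> (size js' <= size js)%N.

Definition initial_set (n : nat) (j : 'I_n.-1) : {set 'I_n} :=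
  [set i : 'I_n | (i <= j)%N].

(* [enum I] lists the elements of I in increasing order. *)
Definition minor (R : realType) (n : nat) (I J : {set 'I_n})
    (eIJ : #|I| = #|J|) (X : 'M[Cplx R]_n) : Cplx R :=
  \det (\matrix_(a < #|I|, b < #|I|)
          X (enum_val a) (enum_val (cast_ord eIJ b))).

Lemma card_perm_imset (n : nat) (u v : 'S_n) (A : {set 'I_n}) :
  #|u @: A| = #|v @: A|.
Proof. by rewrite !card_imset //; apply: perm_inj. Qed.

(* v_k = s_{j_1} ... s_{j_{k-1}}, where k is now a position numbered from 0. *)
Definition KZ_v (n N : nat) (js : N.-tuple 'I_n.-1) (k : 'I_N) : 'S_n :=
  word_perm (take k js).

(* The composition w^-1 o v_k, where w = s_{j_1} ... s_{j_N}. *)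
Definition KZ_u (n N : nat) (js : N.-tuple 'I_n.-1) (k : 'I_N) : 'S_n :=
  (KZ_v js k * (word_perm js)^-1)%g.

Definition KZ_hamiltonian (R : realType) (n N : nat) (js : N.-tuple 'I_n.-1)
    (k : 'I_N) : 'M[Cplx R]_n -> Cplx R :=
  minor (card_perm_imset (KZ_u js k) (KZ_v js k) (initial_set (tnth js k))).

Definition matrix_coord (R : realType) (n : nat) (i j : 'I_n)
  (X : 'M[Cplx R]_n) : Cplx R := X i j.

Definition sgn_diff (a b : nat) : int := Num.sg (a%:Z - b%:Z).

Definition partial_deriv (R : realType) (n : nat) (i j : 'I_n)
    (f : 'M[Cplx R]_n -> Cplx R) (X : 'M[Cplx R]_n) : Cplx R :=
  'D_(delta_mx i j) (f : 'M[Cplx R]_n -> (Cplx R)^o) X.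

(* The biderivation on holomorphic functions on M_n such that
   {x_ij, x_kl} = (sign (k - i) + sign (l - j)) x_il x_kj. *)
Definition pbracket (R : realType) (n : nat)
    (f g : 'M[Cplx R]_n -> Cplx R) (X : 'M[Cplx R]_n) : Cplx R :=
  \sum_(i < n) \sum_(k < n) \sum_(j < n) \sum_(l < n)
    (sgn_diff k i + sgn_diff l j)%:~R * X i l * X k j *
    (partial_deriv i j f X * partial_deriv k l g X).

Definition integral_curve (R : realType) (n : nat)
    (H : 'M[Cplx R]_n -> Cplx R) (X0 : 'M[Cplx R]_n)
    (gamma : Cplx R -> 'M[Cplx R]_n) : Prop :=
  gamma 0 = X0 /\
  forall (t : Cplx R) (i j : 'I_n),
    is_derive (t : (Cplx R)^o) 1 (fun s : (Cplx R)^o => gamma s i j : (Cplx R)^o)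
      (pbracket (matrix_coord i j) H (gamma t)).

Definition complete_flow (R : realType) (n : nat)
    (H : 'M[Cplx R]_n -> Cplx R) : Prop :=
  forall X0 : 'M[Cplx R]_n, exists gamma : Cplx R -> 'M[Cplx R]_n,
    integral_curve H X0 gamma.

(* Analytic means holomorphic in all variables jointly: complex (Frechet)
   differentiable at every point of C^N x M_n. *)
Definition analytic_action (R : realType) (n N : nat)
    (phi : 'rV[Cplx R]_N -> 'M[Cplx R]_n -> 'M[Cplx R]_n) : Prop :=
  [/\ forall X, phi 0 X = X,
      forall z w X, phi (z + w) X = phi z (phi w X) &
      forall p : 'rV[Cplx R]_N * 'M[Cplx R]_n,
        differentiable
          (fun q : 'rV[Cplx R]_N * 'M[Cplx R]_n => phi q.1 q.2) p].

(* The action is generated by the Hamiltonian vector fields of the pairwise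
   Poisson commuting functions H k. *)
Definition hamiltonian_action (R : realType) (n N : nat)
    (H : 'I_N -> 'M[Cplx R]_n -> Cplx R)
    (phi : 'rV[Cplx R]_N -> 'M[Cplx R]_n -> 'M[Cplx R]_n) : Prop :=
  (forall (k l : 'I_N) (X : 'M[Cplx R]_n), pbracket (H k) (H l) X = 0) /\
  (forall (k : 'I_N) (X : 'M[Cplx R]_n),
     integral_curve (H k) X (fun t => phi (t *: delta_mx 0 k) X)).

(* Main.v *)
(* The vector field of a minor F = Delta_(I,J) is X' = A(X) X + X B(X), where
   A(X) has rows outside I and columns in I, and B(X) has rows in J and columns
   outside J.  Along the flow the entries of X in I x J, hence F, are constant,
   and every entry of A(X) and B(X) is multiplied by exp(t s F) with a sign s; as
   A and B have square zero, the flow is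
     X(t) = (1 + \int_0^t A) X (1 + \int_0^t B),
   an explicit entire function of t and of X, also where F vanishes.

   For a reduced word of the longest element, the Hamiltonians are minors
   Delta_(w J, J), with w decreasing, for column sets J which are pairwise
   strongly separated: every element of J \ J' is smaller than every element of
   J' \ J when J precedes J', because a pair of values is inverted only once
   along the word.  The signs in the bracket of two such minors are then constant
   on the terms that do not vanish, and the row part cancels the column part.

   The flows of commuting minors F and G commute: by the Jacobi identity the
   derivations D_F and D_G commute, each coordinate x is killed by
   D_F (D_F^2 - F^2) (D_F^2 - 4 F^2), hence x composed with the flow of F is a
   combination of the D_F^k x, k < 5, with coefficients which depend only on the
   time and on F; composing the expansions for F and G in either order gives the
   same double sum. *)

Require Import Defs.
From HB Require Import structures.
From mathcomp Require Import all_boot all_order all_algebra all_fingroup.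
From mathcomp Require Import all_classical all_reals all_analysis.
From mathcomp Require Import complex.
From mathcomp Require Import ring lra zify.

Set Implicit Arguments.
Unset Strict Implicit.
Unset Printing Implicit Defensive.

Import Order.TTheory GRing.Theory Num.Theory.
Import numFieldNormedType.Exports.

Local Open Scope ring_scope.

(** * Inversions along a reduced word *)

Section Inversions.
Variable n : nat.
Implicit Types (w : 'S_n) (j : 'I_n.-1).

(* An inversion is recorded by its two values, not by its positions. *)
Definition inversions w : {set 'I_n * 'I_n} :=
  [set p : 'I_n * 'I_n | (p.1 < p.2)%N && ((w^-1)%g p.2 < (w^-1)%g p.1)%N].

Let lo j : 'I_n := Ordinal (simple_refl_subproof1 j).
Let hi j : 'I_n := Ordinal (simple_refl_subproof2 j).

Lemma val_simple_refl j (i : 'I_n) :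
  simple_refl j i = (if i == j :> nat then j.+1
                     else if i == j.+1 :> nat then j : nat else i) :> nat.
Proof.
rewrite /simple_refl; case: tpermP => [->|->|ilo ihi] /=.
- by rewrite eqxx.
- by rewrite eqxx; case: eqP => // /esym/n_Sn.
- have -> : (i == j :> nat) = false by apply/eqP => ij; apply: ilo; exact: val_inj.
  by case: eqP => // ij; case: ihi; exact: val_inj.
Qed.

Lemma simple_reflMV j w (i : 'I_n) :
  (simple_refl j * w)^-1%g i = simple_refl j ((w^-1)%g i).
Proof. by rewrite invMg permM /simple_refl tpermV. Qed.

(** In ['S_n] the product [simple_refl j * w] acts by [simple_refl j] first, so it only exchanges
    the contents of positions [j] and [j.+1]; only the two values standing there change their
    relative order. *)
Lemma inversions_simple_refl j w :
  inversions (simple_refl j * w)%g \subset (w (lo j), w (hi j)) |: inversions w.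
Proof.
apply/fintype.subsetP => -[a b]; rewrite !inE /= !simple_reflMV => /andP[ab].
rewrite !val_simple_refl ab /=.
have : (w^-1)%g a != (w^-1)%g b by rewrite (inj_eq perm_inj) neq_ltn ab.
have [aE bE] : a = w ((w^-1)%g a) /\ b = w ((w^-1)%g b) by rewrite !permKV.
rewrite [X in (X, _) == _]aE [X in (_, X) == _]bE xpair_eqE !(inj_eq perm_inj).
rewrite -!val_eqE /=; move: ((w^-1)%g a : nat) ((w^-1)%g b : nat) (j : nat).
by move=> x y m; do 6?[case: eqP => //= ?]; lia.
Qed.

(** At a descent the inversion formed by the two exchanged values is lost, and the one pair that
    could appear is not in increasing order. *)
Lemma inversions_descent j w : (w (hi j) < w (lo j))%N ->
  (#|inversions (simple_refl j * w)%g| < #|inversions w|)%N.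
Proof.
move=> wj; apply/proper_card/properP; split.
  apply/fintype.subsetP => p pI; have := fintype.subsetP (inversions_simple_refl j w) p pI.
  rewrite !inE => /orP[/eqP E|//]; move: pI; rewrite E !inE /= => /andP[].
  by rewrite ltnNge (ltnW wj).
exists (w (hi j), w (lo j)); first by rewrite !inE /= wj !permK /=.
rewrite !inE /= wj !simple_reflMV !permK !val_simple_refl /= eqxx -leqNgt.
by case: eqP => // _; rewrite eqxx.
Qed.

Lemma increasing_perm w : (forall i k : 'I_n, (i < k)%N -> (w i < w k)%N) ->
  forall i : 'I_n, (i <= w i)%N.
Proof.
move=> wI [m mn]; elim: m mn => [//|m IH] mn.
by apply: leq_ltn_trans (IH (ltnW mn)) (wI _ _ _).
Qed.

(** Without descents both [w] and its inverse are increasing; [increasing_perm] for each of them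
    squeezes [w i] to [i]. *)
Lemma ascending_perm1 w : (forall j, (w (lo j) < w (hi j))%N) -> w = 1%g.
Proof.
move=> wA.
have wI (i k : 'I_n) : (i < k)%N -> (w i < w k)%N.
  case: k => k kn /=; elim: k kn i => [//|k IH] kn i ik.
  have kn1 : (k < n.-1)%N by case: (n) kn.
  have wk : (w (Ordinal (ltnW kn)) < w (Ordinal kn))%N.
    by have := wA (Ordinal kn1); congr (w _ < w _)%N; exact: val_inj.
  move: ik; rewrite ltnS leq_eqVlt => /orP[/eqP ik|ik].
    by have -> : i = Ordinal (ltnW kn) by exact: val_inj.
  exact: ltn_trans (IH _ _ ik) wk.
have wVI (i k : 'I_n) : (i < k)%N -> ((w^-1)%g i < (w^-1)%g k)%N.
  move=> ik; rewrite ltnNge leq_eqVlt; apply/negP => /orP[/eqP/val_inj/perm_inj E|/wI].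
    by rewrite E ltnn in ik.
  by rewrite !permKV ltnNge (ltnW ik).
apply/permP => i; rewrite perm1; apply/val_inj/eqP; rewrite eqn_leq.
have := increasing_perm wVI (w i); rewrite permK => ->.
by rewrite increasing_perm.
Qed.

Lemma word_perm_rcons (js : seq 'I_n.-1) j :
  word_perm (rcons js j) = (simple_refl j * word_perm js)%g.
Proof. by rewrite /word_perm rev_rcons big_cons. Qed.

(** Bubble sort: each letter removes a descent, hence at least one inversion. *)
Lemma word_of_perm w : exists2 js : seq 'I_n.-1,
  word_perm js = w & (size js <= #|inversions w|)%N.
Proof.
have [m] := ubnP #|inversions w|; elim: m w => // m IH w wm.
have [/existsP[j wj]|wA] := boolP [exists j, (w (hi j) < w (lo j))%N]; last first.
  exists [::] => //; rewrite /word_perm big_nil; apply/esym/ascending_perm1 => j.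
  move: wA; rewrite negb_exists => /forallP/(_ j); rewrite -leqNgt leq_eqVlt.
  case/orP => // /eqP/val_inj/perm_inj/(congr1 val) /= /n_Sn //.
have lt := inversions_descent wj.
have [|js jsE jsz] := IH (simple_refl j * w)%g; first exact: leq_trans lt _.
exists (rcons js j); last by rewrite size_rcons; apply: leq_trans lt.
by rewrite word_perm_rcons jsE mulgA /simple_refl tperm2 mul1g.
Qed.

Lemma card_lt_pairs : #|[set p : 'I_n * 'I_n | (p.1 < p.2)%N]| = ((n * n.-1) %/ 2)%N.
Proof.
rewrite divn2 -bin2 -bin2_sum big_mkord -sum1_card.
rewrite (eq_bigl (fun p : 'I_n * 'I_n => (p.1 < p.2)%N)) => [|p]; last by rewrite inE.
rewrite -(pair_big_dep xpredT (fun a b : 'I_n => (a < b)%N) (fun _ _ => 1%N)) /=.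
rewrite (exchange_big_dep xpredT) //=; apply: eq_bigr => b _.
by rewrite -(big_ord_widen n (fun=> 1%N) (ltnW (ltn_ord b))) sum1_card card_ord.
Qed.

Lemma card_inversions w : (#|inversions w| <= (n * n.-1) %/ 2)%N.
Proof.
rewrite -card_lt_pairs; apply/subset_leq_card/fintype.subsetP => p.
by rewrite !inE => /andP[].
Qed.

Lemma card_inversions_take (js : seq 'I_n.-1) (k : nat) :
  (#|inversions (word_perm js)| <= #|inversions (word_perm (take k js))| + (size js - k))%N.
Proof.
elim/last_ind: js => [|js j IH]; first by rewrite leq_addr.
rewrite size_rcons; have [kj|kj] := leqP k (size js); last first.
  by rewrite take_oversize ?size_rcons // leq_addr.
rewrite -cats1 takel_cat // cats1 word_perm_rcons subSn // addnS.
apply: leq_trans (subset_leq_card (inversions_simple_refl j _)) _.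
by apply: leq_trans (leq_card_setU _ _) _; rewrite cards1 add1n ltnS.
Qed.

Section MaximalWord.
Variable js : ((n * n.-1) %/ 2).-tuple 'I_n.-1.
Hypothesis js_reduced : reduced js.

(** The word given by [word_of_perm] is no longer than the number of inversions, and a reduced word
    is no longer than that one; the total number of pairs bounds from the other side. *)
Lemma card_inversions_reduced : #|inversions (word_perm js)| = ((n * n.-1) %/ 2)%N.
Proof.
apply/eqP; rewrite eqn_leq card_inversions /=.
have [js' E le] := word_of_perm (word_perm js).
by apply: leq_trans le; rewrite -{1}(size_tuple js); apply: js_reduced.
Qed.

Lemma word_perm_decreasing (a b : 'I_n) : (a < b)%N ->
  ((word_perm js)^-1%g b < (word_perm js)^-1%g a)%N.
Proof.
move=> ab; have : (a, b) \in inversions (word_perm js); last by rewrite inE /= ab.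
have /eqP -> : inversions (word_perm js) == [set p : 'I_n * 'I_n | (p.1 < p.2)%N].
  rewrite eqEcard card_lt_pairs card_inversions_reduced leqnn andbT.
  by apply/fintype.subsetP => p; rewrite !inE => /andP[].
by rewrite inE.
Qed.

(** A letter creates at most one inversion. The first [k] letters thus give at most [k], and they
    cannot give fewer, since the remaining letters must complete the maximal number. *)
Lemma card_inversions_prefix (k : nat) : (k <= (n * n.-1) %/ 2)%N ->
  #|inversions (word_perm (take k js))| = k.
Proof.
move=> kN; apply/eqP; rewrite eqn_leq; apply/andP; split.
  have := card_inversions_take (take k js) 0.
  rewrite take0 size_takel ?size_tuple // subn0.
  suff -> : inversions (word_perm [::]) = finset.set0 by rewrite cards0.
  apply/finset.setP => -[a b]; rewrite !inE /word_perm big_nil invg1 !perm1 /=.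
  by case: ltngtP.
have := card_inversions_take js k.
rewrite card_inversions_reduced size_tuple; move: kN; set N := (_ %/ 2)%N; lia.
Qed.

(** By the exact count of inversions of prefixes, the inclusion of [inversions_simple_refl] is an
    equality at each letter. *)
Lemma inversions_prefix_mono (k l : nat) : (k <= l <= (n * n.-1) %/ 2)%N ->
  inversions (word_perm (take k js)) \subset inversions (word_perm (take l js)).
Proof.
elim: l => [|l IH] /andP[kl lN]; first by move: kl; rewrite leqn0 => /eqP ->.
move: kl; rewrite leq_eqVlt => /orP[/eqP -> //|]; rewrite ltnS => kl.
apply: fintype.subset_trans (IH _) _; first by rewrite kl ltnW.
have j0 : 'I_n.-1 by apply: (tnth js (Ordinal lN)).
have E : take l.+1 js = rcons (take l js) (nth j0 js l).
  by rewrite (take_nth j0) // size_tuple.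
have S := inversions_simple_refl (nth j0 js l) (word_perm (take l js)).
rewrite -word_perm_rcons -E in S.
suff /eqP -> : inversions (word_perm (take l.+1 js)) ==
  (word_perm (take l js) (lo (nth j0 js l)), word_perm (take l js) (hi (nth j0 js l)))
    |: inversions (word_perm (take l js)) by exact: finset.subsetUr.
rewrite eqEcard S (card_inversions_prefix lN).
apply: leq_trans (leq_card_setU _ _) _.
by rewrite cards1 card_inversions_prefix // ltnW.
Qed.

(** If [b < a], then [(b, a)] is an inversion of the prefix [v_k], because [a] sits in its initial
    positions and [b] does not. The inversion persists in [v_l], where the positions of [a] and [b]
    show the opposite order. *)
Lemma KZ_v_separated (k l : 'I_((n * n.-1) %/ 2)) (a b : 'I_n) : (k < l)%N ->
  let J := KZ_v js k @: initial_set (tnth js k) in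
  let J' := KZ_v js l @: initial_set (tnth js l) in
  a \in J :\: J' -> b \in J' :\: J -> (a < b)%N.
Proof.
move=> kl J J'.
have mem_im w (A : {set 'I_n}) c : (c \in w @: A) = ((w^-1)%g c \in A).
  by rewrite -{1}[c](permKV w) (mem_imset _ _ perm_inj).
rewrite !inE !mem_im !inE -!ltnNge => /andP[al ak] /andP[bk bl].
rewrite ltnNge leq_eqVlt; apply/negP => /orP[/eqP/val_inj E|ba].
  by move: bk; rewrite E ltnNge ak.
have kl' : (k <= l <= (n * n.-1) %/ 2)%N by rewrite ltnW // ltnW.
have := fintype.subsetP (inversions_prefix_mono kl') (b, a).
rewrite !inE /= ba /= -/(KZ_v js k) -/(KZ_v js l) => /(_ (leq_ltn_trans ak bk)).
by rewrite ltnNge ltnW // (leq_ltn_trans bl al).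
Qed.

End MaximalWord.
End Inversions.

(** * The complex exponential *)

(** Turns Taylor estimates into complex derivatives; it serves for [cexp] everywhere and for [cexp1]
    at its removable singularity. *)
Lemma is_derive_quadratic_error (K : numFieldType) (f : K^o -> K^o)
    (x df C : K) :
  (forall h : K, `|h| <= 1 -> `|f (h + x) - f x - h * df| <= C * `|h| ^+ 2) ->
  is_derive (x : K^o) 1 f df.
Proof.
move=> fquad.
have C0 : 0 <= C.
  by have := fquad 1; rewrite normr1 expr1n mulr1 => /(_ (lexx _)); apply: le_trans.
have cvgf : ((fun h => h^-1 *: (f (h *: (1 : K^o) + x) - f x)) @ (0 : K)^'
    --> (df : K^o))%classic.
  apply/cvgrPdist_le => e e0.
  have d0 : 0 < e / (C + 1) by rewrite divr_gt0 // ltr_wpDl.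
  near=> h.
  have h0 : h != 0 by near: h; exact: nbhs_dnbhs_neq.
  have hle : `|h| <= e / (C + 1).
    near: h; apply: dnbhs0_le; exact: d0.
  have h1 : `|h| <= 1 by near: h; apply: dnbhs0_le.
  rewrite distrC.
  have -> : h^-1 *: (f (h *: (1 : K^o) + x) - f x) - df =
            h^-1 * (f (h + x) - f x - h * df).
    by rewrite /GRing.scale /= mulr1 [in RHS]mulrBr mulrA mulVf // mul1r.
  rewrite normrM normfV ler_pdivrMl ?normr_gt0 //.
  apply: le_trans (fquad _ h1) _.
  rewrite expr2 mulrA mulrC ler_wpM2l //.
  apply: le_trans (ler_wpM2l C0 hle) _.
  by rewrite mulrA ler_pdivrMr ?ltr_wpDl // mulrC ler_wpM2l ?lerDl // ltW.
split; first by apply/cvg_ex; exists df.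
exact: (cvg_lim (@norm_hausdorff _ _) cvgf).
Unshelve. all: by end_near.
Qed.

(** * Taylor bounds for the real exponential, sine and cosine near 0 *)

Section RealTaylor.
Variable R : realType.

(** By the mean value theorem [f x = df c * x] with [c] between 0 and [x]. Each application
    integrates a Taylor bound once, with the same constant. *)
Lemma le_pow_of_derive (f df : R -> R) (C : R) (n : nat) :
  (forall x : R, is_derive x 1 f (df x)) -> f 0 = 0 ->
  (forall x, `|x| <= 1 -> `|df x| <= C * `|x| ^+ n) ->
  forall x, `|x| <= 1 -> `|f x| <= C * `|x| ^+ n.+1.
Proof.
move=> fD f0 dfle x x1.
have C0 : 0 <= C.
  by have := dfle 1; rewrite normr1 expr1n mulr1 => /(_ (lexx _)); apply: le_trans.
have fc : continuous f.
  by move=> y; apply/differentiable_continuous/derivable1_diffP.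
have [c cx fE] : exists2 c, `|c| <= `|x| & f x = df c * x.
  have [x0|x0|->] := ltgtP x 0; last by exists 0; rewrite ?f0 ?mulr0.
  - have [|c] := @MVT R f df x 0 x0 (fun y _ => fD y).
      exact: continuous_subspaceT.
    rewrite in_itv /= => /andP[xc c0] E.
    exists c; first by rewrite !ltr0_norm // lerN2 ltW.
    by move: E; rewrite f0 !sub0r mulrN => /oppr_inj.
  - have [|c] := @MVT R f df 0 x x0 (fun y _ => fD y).
      exact: continuous_subspaceT.
    rewrite in_itv /= => /andP[c0 xc] E.
    exists c; first by rewrite !gtr0_norm // ltW.
    by move: E; rewrite f0 !subr0.
rewrite fE normrM exprSr mulrA ler_wpM2r //.
apply: le_trans (dfle _ (le_trans cx x1)) _.
by rewrite ler_wpM2l // lerXn2r.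
Qed.

Lemma normr_expR_le4 (x : R) : `|x| <= 1 -> `|expR x| <= 4.
Proof.
move=> x1; rewrite ger0_norm ?expR_ge0 //.
have /le_trans : expR x <= expR 1 by rewrite ler_expR; case/ler_normlP: x1.
apply; have -> : 1 = 2^-1 + 2^-1 :> R by rewrite [LHS]splitr div1r.
rewrite expRD.
(* Invert [exp (- 1/2) >= 1 - 1/2]; squaring then bounds [exp 1] by 4. *)
have h2 : expR (2^-1 : R) <= 2.
  rewrite -[expR _]invrK -expRN invf_ple ?posrE ?expR_gt0 //.
  by have := @expR_ge1Dx R (- 2^-1); lra.
have := expR_ge0 (2^-1 : R); nra.
Qed.

Lemma expR_taylor1 (x : R) : `|x| <= 1 -> `|expR x - 1| <= 4 * `|x|.
Proof.
apply: (@le_pow_of_derive (fun x => expR x - 1) expR 4 0).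
- by move=> y; rewrite -[expR y in X in is_derive _ _ _ X]subr0; apply: is_deriveB.
- by rewrite /= expR0 subrr.
- by move=> y /normr_expR_le4; rewrite mulr1.
Qed.

Lemma expR_taylor2 (x : R) : `|x| <= 1 -> `|expR x - 1 - x| <= 4 * `|x| ^+ 2.
Proof.
apply: (@le_pow_of_derive (fun x => expR x - 1 - x) (fun x => expR x - 1) 4 1).
- by move=> y; apply: is_derive_eq; rewrite subr0.
- by rewrite /= expR0 subrr subr0.
- by move=> y /expR_taylor1.
Qed.

Lemma expR_taylor3 (x : R) : `|x| <= 1 ->
  `|expR x - 1 - x - x ^+ 2 / 2| <= 4 * `|x| ^+ 3.
Proof.
apply: (@le_pow_of_derive (fun x => expR x - 1 - x - x ^+ 2 / 2)
  (fun x => expR x - 1 - x) 4 2).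
- move=> y; apply: is_derive_eq; rewrite subr0 /GRing.scale /=; by field.
- by rewrite /= expR0 subrr subr0 expr0n mul0r subr0.
- by move=> y /expR_taylor2.
Qed.

Lemma sin_taylor1 (x : R) : `|x| <= 1 -> `|sin x| <= 1 * `|x|.
Proof.
apply: (@le_pow_of_derive (@sin R) (@cos R) 1 0).
- exact: sin0.
- by move=> y _; rewrite mulr1 ler_norml cos_geN1 cos_le1.
Qed.

Lemma cos_taylor2 (x : R) : `|x| <= 1 -> `|cos x - 1| <= 1 * `|x| ^+ 2.
Proof.
apply: (@le_pow_of_derive (fun x => cos x - 1) (fun x => - sin x) 1 1).
- by move=> y; apply: is_derive_eq; rewrite subr0.
- by rewrite /= cos0 subrr.
- by move=> y; rewrite normrN; apply: sin_taylor1.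
Qed.

Lemma sin_taylor3 (x : R) : `|x| <= 1 -> `|sin x - x| <= 1 * `|x| ^+ 3.
Proof.
apply: (@le_pow_of_derive (fun x => sin x - x) (fun x => cos x - 1) 1 2).
- by rewrite /= sin0 subrr.
- exact: cos_taylor2.
Qed.

Lemma cos_taylor4 (x : R) : `|x| <= 1 ->
  `|cos x - 1 + x ^+ 2 / 2| <= 1 * `|x| ^+ 4.
Proof.
apply: (@le_pow_of_derive (fun x => cos x - 1 + x ^+ 2 / 2)
  (fun x => - (sin x - x)) 1 3).
- move=> y; apply: is_derive_eq; rewrite subr0 /GRing.scale /=; by field.
- by rewrite /= cos0 subrr expr0n mul0r addr0.
- by move=> y; rewrite normrN; apply: sin_taylor3.
Qed.

End RealTaylor.

Section ComplexExponential.
Variable R : realType.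
Local Open Scope complex_scope.
Local Notation K := (Cplx R).

Definition cexp (z : K) : K :=
  (expR (complex.Re z) * cos (complex.Im z)) +i* (expR (complex.Re z) * sin (complex.Im z)).

Lemma cexpD (z w : K) : cexp (z + w) = cexp z * cexp w.
Proof.
case: z w => [x y] [u v]; rewrite /cexp /= expRD cosD sinD.
by apply/eqP; rewrite eq_complex /=; apply/andP; split; apply/eqP; ring.
Qed.

Lemma cexp0 : cexp 0 = 1.
Proof. by rewrite /cexp /= expR0 cos0 sin0 mulr1 mulr0. Qed.

Lemma normr_complex_le (x y b : R) :
  `|x| + `|y| <= b -> (`|x +i* y : K|) <= b%:C :> K.
Proof.
move=> h; apply: le_trans (_ : (`|x| + `|y|)%:C <= _); last by rewrite lecR.
rewrite normc_def /= lecR -(ger0_norm (addr_ge0 (normr_ge0 x) (normr_ge0 y))).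
rewrite -sqrtr_sqr ler_wsqrtr // sqrrD !real_normK ?num_real //.
have := normr_ge0 x; have := normr_ge0 y; nra.
Qed.

(** The third order is what [cexp1] needs at 0, where one power is lost by division. The real part
    contributes at most 4 + 4 + 2 and the imaginary part at most 4 + 4, in units of [r ^+ 3]. *)
Lemma cexp_taylor3 (z : K) : `|z| <= 1 ->
  `|cexp z - 1 - z - z ^+ 2 / 2| <= 20 * `|z| ^+ 3.
Proof.
case: z => [x y].
have hx : `|x|%:C <= `|x +i* y : K| by exact: (normc_ge_Re (x +i* y)).
have hy : `|y|%:C <= `|x +i* y : K|.
  have := normc_ge_Re (y +i* (- x)).
  by rewrite !normc_def /= sqrrN addrC.
move: hx hy; rewrite normc_def /=; set r := Num.sqrt _.
have -> : (r%:C <= (1 : K)) = (r <= 1) by rewrite -[1]/(1%:C) lecR.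
rewrite !lecR => hx hy r1.
have -> : (x +i* y : K) ^+ 2 / 2 = ((x ^+ 2 - y ^+ 2) / 2) +i* (x * y).
  have -> : (2 : K) = (2 : R)%:C by rewrite rmorph_nat.
  rewrite -fmorphV; apply/eqP; rewrite eq_complex /=.
  by apply/andP; split; apply/eqP; field.
have -> : (20 : K) * r%:C ^+ 3 = (20 * r ^+ 3)%:C.
  by rewrite rmorphM rmorphXn rmorph_nat.
rewrite /cexp /=.
set X := expR x; set c := cos y; set s := sin y.
have -> : ((X * c +i* (X * s)) - 1 - (x +i* y) -
    (((x ^+ 2 - y ^+ 2) / 2) +i* (x * y)) : K) =
   (X * c - 1 - x - (x ^+ 2 - y ^+ 2) / 2) +i* (X * s - y - x * y).
  apply/eqP; rewrite eq_complex /=; apply/andP; split; apply/eqP => //.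
  by rewrite subr0.
apply: normr_complex_le.
have r0 : 0 <= r by exact: sqrtr_ge0.
have x1 := le_trans hx r1; have y1 := le_trans hy r1.
have bnd (C t u : R) k : `|u| <= C * `|t| ^+ k -> 0 <= C -> `|t| <= r ->
    `|u| <= C * r ^+ k.
  move=> /le_trans uC C0 tr; apply: uC.
  by rewrite ler_wpM2l // lerXn2r // nnegrE.
have e1 := bnd _ _ _ 1%N (expR_taylor1 x1) (ler0n _ _) hx.
have e2 := bnd _ _ _ _ (expR_taylor2 x1) (ler0n _ _) hx.
have e3 := bnd _ _ _ _ (expR_taylor3 x1) (ler0n _ _) hx.
have s3 := bnd _ _ _ _ (sin_taylor3 y1) ler01 hy.
have c4 := bnd _ _ _ _ (cos_taylor4 y1) ler01 hy.
have e0 := normr_expR_le4 x1.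
rewrite -/X -/c -/s in e0 e1 e2 e3 s3 c4.
have r43 : r ^+ 4 <= r ^+ 3 by rewrite ler_wiXn2l.
(* Regroup so that each summand is a real Taylor remainder, possibly times a bounded factor or
   another small one. *)
have -> : X * c - 1 - x - (x ^+ 2 - y ^+ 2) / 2 =
    (X - 1 - x - x ^+ 2 / 2) + X * (c - 1 + y ^+ 2 / 2) - (X - 1) * (y ^+ 2 / 2).
  by field.
have -> : X * s - y - x * y = X * (s - y) + (X - 1 - x) * y by ring.
have B1 : `|X * (c - 1 + y ^+ 2 / 2)| <= 4 * (1 * r ^+ 4).
  by rewrite normrM ler_pM.
have B2 : `|(X - 1) * (y ^+ 2 / 2)| <= (4 * r ^+ 1) * (r ^+ 2 / 2).
  rewrite normrM ler_pM // normrM normrX (@gtr0_norm _ 2^-1) ?invr_gt0 //.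
  by rewrite ler_pM2r ?invr_gt0 // lerXn2r // nnegrE.
have B3 : `|X * (s - y)| <= 4 * (1 * r ^+ 3) by rewrite normrM ler_pM.
have B4 : `|(X - 1 - x) * y| <= (4 * r ^+ 2) * r by rewrite normrM ler_pM.
have T1 := ler_normB (X - 1 - x - x ^+ 2 / 2 + X * (c - 1 + y ^+ 2 / 2))
  ((X - 1) * (y ^+ 2 / 2)).
have T2 := ler_normD (X - 1 - x - x ^+ 2 / 2) (X * (c - 1 + y ^+ 2 / 2)).
have T3 := ler_normD (X * (s - y)) ((X - 1 - x) * y).
have E1 : (4 * r ^+ 1) * (r ^+ 2 / 2) = 2 * r ^+ 3 by field.
have E2 : (4 * r ^+ 2) * r = 4 * r ^+ 3 by ring.
have := exprn_ge0 3 r0; lra.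
Qed.

(** The functional equation moves the estimate to 0; there 20 comes from the cubic remainder and 1
    covers the quadratic term. *)
Lemma is_derive_cexp (z : K) : is_derive (z : K^o) 1 (cexp : K^o -> K^o) (cexp z).
Proof.
apply: (@is_derive_quadratic_error _ _ _ _ (`|cexp z| * 21)) => h h1.
have -> : cexp (h + z) - cexp z - h * cexp z =
    cexp z * (cexp h - 1 - h - h ^+ 2 / 2 + h ^+ 2 / 2).
  by rewrite cexpD; field.
rewrite normrM -[leRHS]mulrA; apply: ler_wpM2l => //.
apply: le_trans (ler_normD _ _) _.
have -> : 21 * `|h| ^+ 2 = 20 * `|h| ^+ 2 + `|h| ^+ 2 :> K by ring.
apply: lerD.
  apply: le_trans (cexp_taylor3 h1) _.
  by rewrite ler_wpM2l ?ler0n // ler_wiXn2l.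
by rewrite normrM normrX (@ger0_norm _ 2^-1) ?invr_ge0 ?ler0n //
  ler_piMr ?exprn_ge0 // invf_le1 ?ltr0n // ler1n.
Qed.

(* The entire function [(exp z - 1) / z]. *)
Definition cexp1 (z : K) : K := if z == 0 then 1 else (cexp z - 1) / z.

Lemma cexp1E (z : K) : z * cexp1 z = cexp z - 1.
Proof.
rewrite /cexp1; case: eqVneq => [->|z0]; first by rewrite cexp0 subrr mul0r.
by rewrite mulrC divfK.
Qed.

(** At 0 the third-order estimate divided by [h] leaves a quadratic error around slope 1/2;
    elsewhere [cexp1] agrees with a quotient on a neighbourhood. *)
Lemma differentiable_cexp1 (z : K) : differentiable (cexp1 : K^o -> K^o) z.
Proof.
apply/derivable1_diffP; have [->|z0] := eqVneq z 0.
  apply: (@ex_derive _ _ _ _ _ _ (2^-1 : K^o)).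
  apply: (@is_derive_quadratic_error _ _ _ _ 20) => h h1.
  rewrite addr0 {2}/cexp1 eqxx /cexp1; case: eqVneq => [->|h0].
    by rewrite subrr mul0r subr0 normr0 expr0n mulr0.
  have -> : (cexp h - 1) / h - 1 - h * 2^-1 =
      (cexp h - 1 - h - h ^+ 2 / 2) / h by field.
  rewrite normrM normfV ler_pdivrMr ?normr_gt0 // -mulrA -exprSr.
  exact: cexp_taylor3.
have dq : derivable ((fun w : K^o => (cexp w - 1) / w) : K^o -> K^o) z 1.
  apply: (@derivableM _ _ (fun w : K^o => cexp w - 1 : K^o) (fun w : K^o => w^-1 : K^o)).
    apply: (@derivableB _ _ _ (cexp : K^o -> K^o) (cst (1 : K^o))).
      exact: (@ex_derive _ _ _ _ _ _ _ (is_derive_cexp z)).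
    exact: derivable_cst.
  by apply: (@derivableV _ _ (id : K^o -> K^o)) => //; apply: derivable_id.
apply: near_eq_derivable dq; near=> w; rewrite /cexp1 ifN //.
by near: w; apply: (cvgr_neq0 z).
Unshelve. all: by end_near.
Qed.

End ComplexExponential.

Lemma is_derive1_chain (K : numFieldType) (f g : K^o -> K^o) (x df dg : K) :
  is_derive (g x : K^o) 1 f df -> is_derive (x : K^o) 1 g dg ->
  is_derive (x : K^o) 1 (f \o g) (df * dg).
Proof.
move=> [/derivable1_diffP fd fE] [/derivable1_diffP gd gE].
have cd : differentiable (f \o g) x by exact: differentiable_comp.
split; first exact/derivable1_diffP.
rewrite deriveE // diff_comp // /comp -!deriveE // gE -[dg]mulr1.
have -> : dg * 1 = dg *: (1 : K^o) by [].
by rewrite deriveE // linearZ /= -deriveE // fE /GRing.scale /= mulr1 mulrC.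
Qed.

(** * Calculus rules for derivatives of functions of one complex variable *)

Section ComplexDerivative.
Variable R : realType.
Local Notation K := (Cplx R).

Definition cderiv (f : K -> K) (t l : K) : Prop :=
  is_derive (t : K^o) 1 (f : K^o -> K^o) l.

Lemma cderiv_eq (f : K -> K) (t l l' : K) :
  cderiv f t l -> l = l' -> cderiv f t l'.
Proof. by move=> ? <-. Qed.

Lemma cderiv_ext (f g : K -> K) (t l : K) :
  f =1 g -> cderiv f t l -> cderiv g t l.
Proof. by move=> /funext ->. Qed.

Lemma cderiv_unique (f : K -> K) (t l l' : K) :
  cderiv f t l -> cderiv f t l' -> l = l'.
Proof. by move=> [_ <-] [_ <-]. Qed.

Lemma cderiv_cst (c t : K) : cderiv (fun=> c) t 0.
Proof. exact: is_derive_cst. Qed.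

Lemma cderiv_id (t : K) : cderiv id t 1.
Proof. exact: is_derive_id. Qed.

Lemma cderivD (f g : K -> K) (t a b : K) :
  cderiv f t a -> cderiv g t b -> cderiv (fun s => f s + g s) t (a + b).
Proof. by move=> fa gb; apply: (@is_deriveD _ _ _ (f : K^o -> K^o) g). Qed.

Lemma cderivM (f g : K -> K) (t a b : K) :
  cderiv f t a -> cderiv g t b ->
  cderiv (fun s => f s * g s) t (a * g t + f t * b).
Proof.
move=> fa gb; rewrite addrC [a * _]mulrC.
exact: (@is_deriveM _ _ (f : K^o -> K^o) g).
Qed.

Lemma cderivZ (f : K -> K) (c t a : K) :
  cderiv f t a -> cderiv (fun s => c * f s) t (c * a).
Proof. by move=> fa; apply: (@is_deriveZ _ _ _ (f : K^o -> K^o)). Qed.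

Lemma cderivN (f : K -> K) (t a : K) :
  cderiv f t a -> cderiv (fun s => - f s) t (- a).
Proof. by move=> fa; apply: (@is_deriveN _ _ _ (f : K^o -> K^o)). Qed.

Lemma cderivB (f g : K -> K) (t a b : K) :
  cderiv f t a -> cderiv g t b -> cderiv (fun s => f s - g s) t (a - b).
Proof. by move=> fa gb; apply: cderivD => //; apply: cderivN. Qed.

Lemma cderiv_sum (I : Type) (r : seq I) (f : I -> K -> K) (t : K) (a : I -> K) :
  (forall i, cderiv (f i) t (a i)) ->
  cderiv (fun s => \sum_(i <- r) f i s) t (\sum_(i <- r) a i).
Proof.
move=> fa; elim: r => [|i r IH].
  by rewrite big_nil; apply: (cderiv_ext _ (cderiv_cst 0 t)) => s; rewrite big_nil.
rewrite big_cons; apply: (cderiv_ext _ (cderivD (fa i) IH)) => s.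
by rewrite big_cons.
Qed.

Lemma cderiv_comp (f g : K -> K) (t a b : K) :
  cderiv f (g t) a -> cderiv g t b -> cderiv (f \o g) t (a * b).
Proof. exact: (@is_derive1_chain _ f g). Qed.

End ComplexDerivative.

(** * Linear differential equations in complex time *)

Section ComplexODE.
Variable R : realType.
Local Open Scope complex_scope.
Local Notation K := (Cplx R).

(** The integral of [exp (s d)] for [s] from 0 to [t], written so that it stays entire in both
    variables across [d = 0]. *)
Definition cexpint (t d : K) : K := t * cexp1 (t * d).

Lemma cexpintE (t d : K) : d * cexpint t d = cexp (t * d) - 1.
Proof. by rewrite /cexpint mulrA [d * t]mulrC cexp1E. Qed.

Lemma cexpint0 (d : K) : cexpint 0 d = 0.
Proof. by rewrite /cexpint mul0r. Qed.

Lemma cderiv_cexpM (t d : K) :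
  cderiv (fun s => cexp (s * d)) t (d * cexp (t * d)).
Proof.
have -> : d * cexp (t * d) = cexp (t * d) * (1 * d + t * 0).
  by rewrite mul1r mulr0 addr0 mulrC.
apply: (@cderiv_comp _ (@cexp R) (fun s => s * d)); first exact: is_derive_cexp.
by apply: cderivM; [exact: cderiv_id | exact: cderiv_cst].
Qed.

Lemma cderiv_cexpint (t d : K) : cderiv (cexpint^~ d) t (cexp (t * d)).
Proof.
have [->|d0] := eqVneq d 0.
  rewrite mulr0 cexp0; apply: cderiv_ext (cderiv_id t) => s.
  by rewrite /cexpint mulr0 /cexp1 eqxx mulr1.
have -> : cexp (t * d) = d^-1 * (d * cexp (t * d) - 0).
  by rewrite subr0 mulKf.
apply: (@cderiv_ext _ (fun s => d^-1 * (cexp (s * d) - 1))).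
  by move=> s; rewrite -cexpintE mulKf.
by apply/cderivZ/cderivB; [exact: cderiv_cexpM | exact: cderiv_cst].
Qed.

(** Restricted to the segment from 0 to [z], the real part of a multiple [c * f] is a real function
    with zero derivative, to which the theorem on the real line applies. *)
Lemma cderiv0_constant (f : K -> K) :
  (forall z : K, cderiv f z 0) -> forall z : K, f z = f 0.
Proof.
pose L (c : K) : R := complex.Re c.
suff re0 (F : K -> K) : (forall z : K, cderiv F z 0) -> L (F 1) = L (F 0).
  move=> fD z.
  have Fz (c : K) : L (c * f z) = L (c * f 0).
    have := re0 (fun w => c * f (w * z)).
    rewrite mul1r mul0r; apply => w.
    rewrite -[0](mulr0 c); apply: cderivZ.
    rewrite -[0](mul0r (1 * z + w * 0)).
    apply: (@cderiv_comp _ f (fun w => w * z)) => //.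
    by apply: cderivM; [exact: cderiv_id | exact: cderiv_cst].
  (* The multiples by 1 and by [-i] give the real and the imaginary part of [f]. *)
  have := Fz 1; have := Fz (0 +i* (-1)); rewrite !mul1r.
  case: (f z) (f 0) => [x y] [u v] /=.
  by rewrite !mul0r !mulN1r !opprK !add0r => -> ->.
move=> FD.
have : L (F ((1 : R)%:C)) = L (F ((0 : R)%:C)).
  apply: (@is_derive_0_is_cst _ (fun r : R => L (F r%:C))) => r.
  have [/cvg_ex[/= l Fl] FE] := FD r%:C.
  have l0 : l = 0 by rewrite -FE; apply/esym/(cvg_lim (@norm_hausdorff _ _) Fl).
  rewrite {}l0 in Fl.
  (* Real difference quotients are real parts of complex ones with real increment, and
     [|Re z| <= |z|]. *)
  have cvgr : ((fun h : R => h^-1 *: (L (F (h *: 1 + r)%:C) - L (F r%:C))) @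
      (0 : R)^' --> (0 : R))%classic.
    apply/cvgrPdist_le => e e0.
    move/cvgrPdist_le : Fl => /(_ e%:C); rewrite ltcR => /(_ e0).
    case => /= d; rewrite ltcE /= => /andP[/eqP dI dR] dP.
    exists (complex.Re d) => //= h; rewrite /= sub0r normrN => hd h0.
    have nh : `|h%:C : K| = `|h|%:C.
      by rewrite normc_def /= expr0n addr0 sqrtr_sqr.
    have := dP h%:C; rewrite /= sub0r normrN nh ltcE /= dI eqxx /= => /(_ hd).
    have hC0 : (h%:C : K) != 0 by apply: contra_neq h0 => /complexI.
    move=> /(_ hC0); rewrite sub0r normrN sub0r normrN => le_e.
    rewrite -lecR; apply: le_trans le_e; apply: le_trans (normc_ge_Re _).
    have -> : (h *: (1 : R) + r)%:C = h%:C *: (1 : K^o) + r%:C :> K.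
      by rewrite /GRing.scale /= !mulr1 rmorphD.
    rewrite lecR /L; case: (F _) (F _) => [x y] [u v] /=.
    rewrite /GRing.scale /= expr0n addr0 mul0r oppr0 mul0r subr0.
    by rewrite expr2 invfM mulrA divff // mul1r.
  split; first by apply/cvg_ex; exists 0.
  exact: (cvg_lim (@norm_hausdorff _ _) cvgr).
by [].
Qed.

Lemma linear_ode1 (f : K -> K) (c : K) :
  (forall t : K, cderiv f t (c * f t)) -> forall t : K, f t = cexp (t * c) * f 0.
Proof.
move=> fD t.
have gD s : cderiv (fun s => cexp (s * - c) * f s) s 0.
  apply: cderiv_eq (cderivM (cderiv_cexpM s (- c)) (fD s)) _; ring.
have := cderiv0_constant gD t.
rewrite /= mul0r cexp0 mul1r => <-.
by rewrite mulrA -cexpD mulrN subrr cexp0 mul1r.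
Qed.

End ComplexODE.

Section LinearODE5.
Variable R : realType.
Local Notation K := (Cplx R).

(* The characteristic polynomial is [z (z^2 - d^2) (z^2 - 4 d^2)]; for [d != 0]
   its roots [0, d, - d, 2 d, - 2 d] are simple and the five combinations [w] of
   the proof are the corresponding eigenfunctions. *)
Lemma ode5_solution (d t : K) : exists b : nat -> K,
  forall y : nat -> K -> K,
    (forall (k : nat) (s : K), cderiv (y k) s (y k.+1 s)) ->
    (forall s : K, y 5%N s = 5 * d ^+ 2 * y 3%N s - 4 * d ^+ 4 * y 1%N s) ->
    y 0%N t = \sum_(m < 5) b m * y m 0.
Proof.
have [->|d0] := eqVneq d 0.
  (* For [d = 0] the fifth derivative vanishes, so solutions are polynomials of degree at most 4. *)
  exists (fun m => nth 0 [:: 1; t; t ^+ 2 / 2; t ^+ 3 / 6; t ^+ 4 / 24] m).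
  move=> y yD y5.
  have y50 s : y 5%N s = 0 by rewrite y5 !expr0n !mulr0 !mul0r subrr.
  (* The Taylor polynomial at [s], evaluated at [t]: constant in [s], with value [y 0 t] at
     [s = t]. *)
  pose q s := y 0%N s + (t - s) * y 1%N s + (t - s) ^+ 2 / 2 * y 2%N s +
    (t - s) ^+ 3 / 6 * y 3%N s + (t - s) ^+ 4 / 24 * y 4%N s.
  have tD s : cderiv (fun s => t - s) s (0 - 1).
    by apply: cderivB; [exact: cderiv_cst | exact: cderiv_id].
  have pD n s : cderiv (fun s => (t - s) ^+ n.+1) s (- n.+1%:R * (t - s) ^+ n).
    elim: n => [|n IH]; first by rewrite expr0 mulr1 -sub0r; exact: tD.
    apply: (@cderiv_ext _ (fun s => (t - s) * (t - s) ^+ n.+1)).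
      by move=> u; rewrite -exprS.
    apply: cderiv_eq (cderivM (tD s) IH) _.
    by rewrite exprS -[n.+2]addn1 natrD; ring.
  have qD s : cderiv q s 0.
    rewrite /q; have D c n k :
        cderiv (fun s => (t - s) ^+ n.+1 / c * y k s) s
          (- n.+1%:R * (t - s) ^+ n / c * y k s + (t - s) ^+ n.+1 / c * y k.+1 s).
      apply: cderivM => //; apply: cderiv_eq (cderivM (pD n s) (cderiv_cst c^-1 s)) _.
      by rewrite mulr0 addr0.
    apply: cderiv_eq (cderivD (cderivD (cderivD (cderivD (yD 0%N s)
      (cderivM (tD s) (yD 1%N s))) (D 2 1%N 2%N)) (D 6 2%N 3%N)) (D 24 3%N 4%N)) _.
    by rewrite y50; field.
  have := cderiv0_constant qD t.
  rewrite /q /= subrr !expr0n /= !mul0r !addr0 subr0 => ->.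
  by rewrite !big_ord_recr big_ord0 /=; ring.
pose e k := cexp (t * (k * d)).
exists (fun m => (24 * d ^+ 4)^-1 * nth 0 [:: 24 * d ^+ 4;
   2 * d ^+ 3 * (8 * e 1 - 8 * e (-1) - e 2 + e (- 2));
   d ^+ 2 * (- 30 + 16 * e 1 + 16 * e (-1) - e 2 - e (- 2));
   2 * d * (- 2 * e 1 + 2 * e (- 1) + e 2 - e (- 2));
   6 - 4 * e 1 - 4 * e (- 1) + e 2 + e (- 2)] m) => y yD y5.
pose w a c g h k s :=
  a * y 0%N s + c * y 1%N s + g * y 2%N s + h * y 3%N s + k * y 4%N s.
have wD a c g h k s : cderiv (w a c g h k) s
    (a * y 1%N s + c * y 2%N s + g * y 3%N s + h * y 4%N s + k * y 5%N s).
  by do 4?[apply: cderivD]; apply: cderivZ.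
have wE a c g h k l : (forall s : K, a * y 1%N s + c * y 2%N s + g * y 3%N s +
      h * y 4%N s + k * y 5%N s = l * d * w a c g h k s) ->
    w a c g h k t = e l * w a c g h k 0.
  by move=> wl; apply: linear_ode1 => s; rewrite -wl; exact: wD.
(* For each root [l * d] the coefficients are those of the characteristic polynomial divided by
   [z - l * d]. *)
have w0 := wE (4 * d ^+ 4) 0 (- 5 * d ^+ 2) 0 1 0.
have w1 := wE 0 (- 4 * d ^+ 3) (- 4 * d ^+ 2) d 1 1.
have w1' := wE 0 (4 * d ^+ 3) (- 4 * d ^+ 2) (- d) 1 (- 1).
have w2 := wE 0 (- 2 * d ^+ 3) (- d ^+ 2) (2 * d) 1 2.
have w2' := wE 0 (2 * d ^+ 3) (- d ^+ 2) (- 2 * d) 1 (- 2).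
move: w0 w1 w1' w2 w2'; rewrite /w => w0 w1 w1' w2 w2'.
have e0 : e 0 = 1 by rewrite /e mul0r mulr0 cexp0.
have {}w0 := w0 (fun s => ltac:(rewrite y5; ring)).
have {}w1 := w1 (fun s => ltac:(rewrite y5; ring)).
have {}w1' := w1' (fun s => ltac:(rewrite y5; ring)).
have {}w2 := w2 (fun s => ltac:(rewrite y5; ring)).
have {}w2' := w2' (fun s => ltac:(rewrite y5; ring)).
have d4 : 24 * d ^+ 4 != 0 by rewrite mulf_neq0 ?pnatr_eq0 ?expf_neq0.
apply: (mulfI d4).
rewrite e0 in w0; rewrite !big_ord_recr big_ord0 /=.
(* The weights 6, -4, -4, 1, 1 cancel the derivatives of orders 1 to 4 and leave
   [24 * d ^+ 4 * y 0 t]. *)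
transitivity (6 * (4 * d ^+ 4 * y 0%N t + 0 * y 1%N t + - 5 * d ^+ 2 * y 2%N t + 0 * y 3%N t + 1 * y 4%N t)
 - 4 * (0 * y 0%N t + - 4 * d ^+ 3 * y 1%N t + - 4 * d ^+ 2 * y 2%N t + d * y 3%N t + 1 * y 4%N t)
 - 4 * (0 * y 0%N t + 4 * d ^+ 3 * y 1%N t + - 4 * d ^+ 2 * y 2%N t + - d * y 3%N t + 1 * y 4%N t)
 + (0 * y 0%N t + - 2 * d ^+ 3 * y 1%N t + - d ^+ 2 * y 2%N t + 2 * d * y 3%N t + 1 * y 4%N t)
 + (0 * y 0%N t + 2 * d ^+ 3 * y 1%N t + - d ^+ 2 * y 2%N t + - 2 * d * y 3%N t + 1 * y 4%N t)).
  ring.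
rewrite w0 w1 w1' w2 w2'; field.
by rewrite d0.
Qed.

End LinearODE5.

(** * The Poisson bracket on polynomial functions *)

(* The bracket is sealed: comparing two brackets up to conversion would unfold
   the derivatives inside them. *)
HB.lock Definition poisson (R : realType) (n : nat)
  (f g : 'M[Cplx R]_n -> Cplx R) (X : 'M[Cplx R]_n) : Cplx R := pbracket f g X.

Lemma poissonE (R : realType) (n : nat) (f g : 'M[Cplx R]_n -> Cplx R) X :
  poisson f g X = pbracket f g X.
Proof. by rewrite poisson.unlock. Qed.

Section PolynomialFunctions.
Variables (R : realType) (n : nat).
Local Notation K := (Cplx R).
Local Notation fn := ('M[K]_n -> K).
Implicit Types (f g h H : fn) (X : 'M[K]_n).

(** Given by generators so that identities between derivations, known on coordinates, extend to
    polynomials by induction. *)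
Inductive polyfun : fn -> Prop :=
| polyfun_cst (c : K) : polyfun (fun=> c)
| polyfun_coord (i j : 'I_n) : polyfun (matrix_coord i j)
| polyfunD f g : polyfun f -> polyfun g -> polyfun (fun X => f X + g X)
| polyfunM f g : polyfun f -> polyfun g -> polyfun (fun X => f X * g X).

Lemma polyfun_ext f g : f =1 g -> polyfun f -> polyfun g.
Proof. by move=> /funext ->. Qed.

Lemma polyfun_sum (I : Type) (r : seq I) (f : I -> fn) :
  (forall i, polyfun (f i)) -> polyfun (fun X => \sum_(i <- r) f i X).
Proof.
move=> pf; elim: r => [|i r IH].
  by apply: (polyfun_ext _ (polyfun_cst 0)) => X; rewrite big_nil.
by apply: (polyfun_ext _ (polyfunD (pf i) IH)) => X; rewrite big_cons.
Qed.

Lemma polyfun_prod (I : Type) (r : seq I) (f : I -> fn) :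
  (forall i, polyfun (f i)) -> polyfun (fun X => \prod_(i <- r) f i X).
Proof.
move=> pf; elim: r => [|i r IH].
  by apply: (polyfun_ext _ (polyfun_cst 1)) => X; rewrite big_nil.
by apply: (polyfun_ext _ (polyfunM (pf i) IH)) => X; rewrite big_cons.
Qed.

Lemma differentiable_polyfun f X :
  polyfun f -> differentiable (f : 'M[K]_n -> K^o) X.
Proof.
elim=> {f} [c|i j|f g _ df _ dg|f g _ df _ dg].
- exact: differentiable_cst.
- exact: differentiable_coord.
- exact: (@differentiableD _ _ _ (f : 'M[K]_n -> K^o) g).
- exact: (@differentiableM _ _ (f : 'M[K]_n -> K^o) g).
Qed.

Lemma derivable_polyfun f X V : polyfun f -> derivable (f : 'M[K]_n -> K^o) X V.
Proof. by move=> /differentiable_polyfun/diff_derivable. Qed.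

Lemma partial_deriv_cst i j (c : K) X : partial_deriv i j (fun=> c) X = 0.
Proof. exact: derive_cst. Qed.

Lemma partial_deriv_affine i j f X (c : K) :
  (forall t : K, f (t *: delta_mx i j + X) = f X + t * c) ->
  partial_deriv i j f X = c.
Proof.
move=> fX; rewrite /partial_deriv /derive.
apply: (cvg_lim (@norm_hausdorff _ _)); apply: cvg_near_cst.
near=> t; rewrite /= fX addrAC subrr add0r /GRing.scale /= mulKf //.
by near: t; exact: nbhs_dnbhs_neq.
Unshelve. all: by end_near.
Qed.

Lemma partial_deriv_coord i j k l X :
  partial_deriv i j (matrix_coord k l) X = ((k == i) && (l == j))%:R.
Proof.
by apply: partial_deriv_affine => t; rewrite /matrix_coord !mxE addrC.
Qed.

Lemma partial_derivD i j f g X : polyfun f -> polyfun g ->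
  partial_deriv i j (fun X => f X + g X) X =
  partial_deriv i j f X + partial_deriv i j g X.
Proof.
by move=> pf pg; apply: (@deriveD _ _ _ (f : 'M[K]_n -> K^o) g);
  apply: derivable_polyfun.
Qed.

Lemma partial_derivM i j f g X : polyfun f -> polyfun g ->
  partial_deriv i j (fun X => f X * g X) X =
  f X * partial_deriv i j g X + g X * partial_deriv i j f X.
Proof.
by move=> pf pg; apply: (@deriveM _ _ (f : 'M[K]_n -> K^o) g);
  apply: derivable_polyfun.
Qed.

Lemma polyfun_partial_deriv i j f : polyfun f -> polyfun (partial_deriv i j f).
Proof.
elim=> {f} [c|k l|f g pf df pg dg|f g pf df pg dg].
- by apply: (polyfun_ext _ (polyfun_cst 0)) => X; rewrite partial_deriv_cst.
- apply: (polyfun_ext _ (polyfun_cst ((k == i) && (l == j))%:R)) => X.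
  by rewrite partial_deriv_coord.
- by apply: (polyfun_ext _ (polyfunD df dg)) => X; rewrite partial_derivD.
- apply: (polyfun_ext _ (polyfunD (polyfunM pf dg) (polyfunM pg df))) => X.
  by rewrite partial_derivM.
Qed.

Lemma polyfun_poisson f g : polyfun f -> polyfun g -> polyfun (poisson f g).
Proof.
move=> pf pg; apply: (polyfun_ext (fun X => esym (poissonE f g X))).
do 4!apply: polyfun_sum => ?.
apply: polyfunM; last by apply: polyfunM; apply: polyfun_partial_deriv.
by do 2![apply: polyfunM; last exact: polyfun_coord]; apply: polyfun_cst.
Qed.

Lemma sgn_diffE (a b : nat) : sgn_diff a b = (b < a)%N%:Z - (a < b)%N%:Z.
Proof.
rewrite /sgn_diff; case: (ltngtP a b) => ab.
- by rewrite ltr0_sg // subr_lt0 ltz_nat.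
- by rewrite gtr0_sg // subr_gt0 ltz_nat.
- by rewrite ab subrr sgr0.
Qed.

Lemma sgn_diffC (a b : nat) : sgn_diff a b = - sgn_diff b a.
Proof. by rewrite !sgn_diffE opprB. Qed.

Lemma sgn_diffxx (a : nat) : sgn_diff a a = 0.
Proof. by rewrite /sgn_diff subrr sgr0. Qed.

Lemma poissonC f g X : poisson f g X = - poisson g f X.
Proof.
rewrite !poissonE /pbracket -sumrN exchange_big /=; apply: eq_bigr => k _.
rewrite -sumrN; apply: eq_bigr => i _.
rewrite [LHS]exchange_big /= -sumrN; apply: eq_bigr => l _.
rewrite -sumrN; apply: eq_bigr => j _.
rewrite (sgn_diffC i k) (sgn_diffC j l) -opprD mulrNz.
move: (_%:~R) (X i l) (X k j) (partial_deriv i j f X) (partial_deriv k l g X).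
by move=> c x y p q; ring.
Qed.

Lemma poisson_eq0 f X : poisson f f X = 0.
Proof.
apply/eqP; have := poissonC f f X => /eqP; rewrite -addr_eq0 -mulr2n mulrn_eq0.
by [].
Qed.

Lemma poisson_cstl (c : K) g X : poisson (fun=> c) g X = 0.
Proof.
by rewrite !poissonE /pbracket; do 4!(apply: big1 => ? _);
  rewrite partial_deriv_cst mul0r mulr0.
Qed.

Lemma poissonDl f g h X : polyfun f -> polyfun g ->
  poisson (fun X => f X + g X) h X = poisson f h X + poisson g h X.
Proof.
move=> pf pg; rewrite !poissonE /pbracket.
do 4!(rewrite -big_split /=; apply: eq_bigr => ? _).
by rewrite partial_derivD // mulrDl mulrDr.
Qed.

Lemma poissonMl f g h X : polyfun f -> polyfun g ->
  poisson (fun X => f X * g X) h X =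
  f X * poisson g h X + g X * poisson f h X.
Proof.
move=> pf pg; rewrite !poissonE /pbracket.
do 4!(rewrite 2!mulr_sumr -big_split /=; apply: eq_bigr => ? _).
rewrite partial_derivM //; move: (_%:~R * _ * _) (f X) (g X) => a b c.
by move: (partial_deriv _ _ _ _) (partial_deriv _ _ _ _) (partial_deriv _ _ _ _) => p q r; ring.
Qed.

Lemma poissonDr f g h X : polyfun g -> polyfun h ->
  poisson f (fun X => g X + h X) X = poisson f g X + poisson f h X.
Proof. by move=> *; rewrite poissonC poissonDl // opprD (poissonC f g) (poissonC f h). Qed.

Lemma poissonMr f g h X : polyfun g -> polyfun h ->
  poisson f (fun X => g X * h X) X =
  g X * poisson f h X + h X * poisson f g X.
Proof. by move=> *; rewrite poissonC poissonMl // opprD (poissonC f g) (poissonC f h) !mulrN. Qed.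

Lemma poisson_cstr f (c : K) X : poisson f (fun=> c) X = 0.
Proof. by rewrite poissonC poisson_cstl oppr0. Qed.

Lemma poisson_coord i j h X :
  poisson (matrix_coord i j) h X =
  \sum_(k < n) \sum_(l < n) (sgn_diff k i + sgn_diff l j)%:~R * X i l * X k j *
     partial_deriv k l h X.
Proof.
rewrite !poissonE /pbracket (bigD1 i) //= [X in _ + X]big1 ?addr0 => [|i' i'i]; last first.
  do 3!(apply: big1 => ? _); rewrite partial_deriv_coord.
  by rewrite eq_sym (negPf i'i) mul0r mulr0.
apply: eq_bigr => k _; rewrite (bigD1 j) //= [X in _ + X]big1 ?addr0 => [|j' j'j].
  by apply: eq_bigr => l _; rewrite partial_deriv_coord !eqxx mul1r.
apply: big1 => ? _; rewrite partial_deriv_coord.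
by rewrite [j == _]eq_sym (negPf j'j) andbF mul0r mulr0.
Qed.

Lemma poisson_coord2 i j k l X :
  poisson (matrix_coord i j) (matrix_coord k l) X =
  (sgn_diff k i + sgn_diff l j)%:~R * X i l * X k j.
Proof.
rewrite poisson_coord (bigD1 k) //= [X in _ + X]big1 ?addr0 => [|k' k'k].
  rewrite (bigD1 l) //= [X in _ + X]big1 ?addr0 => [|l' l'l].
    by rewrite partial_deriv_coord !eqxx mulr1.
  by rewrite partial_deriv_coord [l == _]eq_sym (negPf l'l) andbF mulr0.
by apply: big1 => ? _; rewrite partial_deriv_coord eq_sym (negPf k'k) mulr0.
Qed.

Definition jacobiator f g h X : K :=
  poisson f (poisson g h) X + poisson g (poisson h f) X +
  poisson h (poisson f g) X.

Lemma jacobiatorC f g h X : jacobiator f g h X = jacobiator g h f X.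
Proof. rewrite /jacobiator -[LHS]addrA [LHS]addrC; reflexivity. Qed.

(** The jacobiator is a derivation in its first argument, so its vanishing on coordinates
    suffices. *)
Lemma jacobiator_generated g h : polyfun g -> polyfun h ->
  (forall i j X, jacobiator (matrix_coord i j) g h X = 0) ->
  forall f, polyfun f -> forall X, jacobiator f g h X = 0.
Proof.
move=> pg ph Jij f; elim=> {f} [c|i j|f1 f2 p1 J1 p2 J2|f1 f2 p1 J1 p2 J2] X //.
- rewrite /jacobiator poisson_cstl add0r.
  have -> : poisson h (fun=> c) = fun=> 0.
    by apply/funext => Y; rewrite poisson_cstr.
  have -> : poisson (fun=> c) g = fun=> 0.
    by apply/funext => Y; rewrite poisson_cstl.
  by rewrite !poisson_cstr addr0.
- have -> : jacobiator (fun X => f1 X + f2 X) g h X =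
      jacobiator f1 g h X + jacobiator f2 g h X; last by rewrite J1 J2 addr0.
  rewrite /jacobiator poissonDl //.
  have -> : poisson h (fun X => f1 X + f2 X) =
      (fun X => poisson h f1 X + poisson h f2 X).
    by apply/funext => Y; rewrite poissonDr.
  have -> : poisson (fun X => f1 X + f2 X) g =
      (fun X => poisson f1 g X + poisson f2 g X).
    by apply/funext => Y; rewrite poissonDl.
  rewrite !poissonDr; do ?exact: polyfun_poisson.
  have alg (a b c d e u : K) :
    (a + b) + (c + d) + (e + u) = (a + c + e) + (b + d + u) by ring.
  exact: alg.
- have -> : jacobiator (fun X => f1 X * f2 X) g h X =
      f1 X * jacobiator f2 g h X + f2 X * jacobiator f1 g h X.
    rewrite /jacobiator poissonMl //.
    have -> : poisson h (fun X => f1 X * f2 X) =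
        (fun X => f1 X * poisson h f2 X + f2 X * poisson h f1 X).
      by apply/funext => Y; rewrite poissonMr.
    have -> : poisson (fun X => f1 X * f2 X) g =
        (fun X => f1 X * poisson f2 g X + f2 X * poisson f1 g X).
      by apply/funext => Y; rewrite poissonMl.
    have [p1g p2g] := (polyfun_poisson p1 pg, polyfun_poisson p2 pg).
    have [p1h p2h] := (polyfun_poisson ph p1, polyfun_poisson ph p2).
    rewrite !poissonDr; do ?exact: polyfunM.
    rewrite (poissonMr g X p1 p2h) (poissonMr g X p2 p1h).
    rewrite (poissonMr h X p1 p2g) (poissonMr h X p2 p1g).
    rewrite (poissonC g f1) (poissonC g f2).
    (* The mixed products of first-order brackets cancel in pairs by antisymmetry. *)
    have alg (x y a b c d e u G1 G2 H1 H2 : K) :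
      x * b + y * a + (x * d + H2 * - G1 + (y * c + H1 * - G2)) +
      (x * u + G2 * H1 + (y * e + G1 * H2)) =
      x * (b + d + u) + y * (a + c + e) by ring.
    exact: alg.
  by rewrite J1 J2 !mulr0 addr0.
Qed.

(** This value does not depend on the order of the indices, which makes the row and column
    contributions to the Jacobi identity cancel. *)
Lemma sgn_diff_cyclic (a b c : nat) : ~~ ((a == b) && (b == c)) ->
  sgn_diff b a * sgn_diff c b + sgn_diff c b * sgn_diff a c +
  sgn_diff a c * sgn_diff b a = -1.
Proof.
rewrite !sgn_diffE.
by case: (ltngtP a b); case: (ltngtP b c); case: (ltngtP a c) => //=; lia.
Qed.

Lemma jacobi_coord i j k l p q X :
  jacobiator (matrix_coord i j) (matrix_coord k l) (matrix_coord p q) X = 0.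
Proof.
have E (a b c d e f : 'I_n) : poisson (matrix_coord a b)
      (poisson (matrix_coord c d) (matrix_coord e f)) X =
    (sgn_diff e c + sgn_diff f d)%:~R *
    (X c f * ((sgn_diff e a + sgn_diff d b)%:~R * X a d * X e b) +
     X e d * ((sgn_diff c a + sgn_diff f b)%:~R * X a f * X c b)).
  have -> : poisson (matrix_coord c d) (matrix_coord e f) =
      (fun X => (sgn_diff e c + sgn_diff f d)%:~R *
         (matrix_coord c f X * matrix_coord e d X)).
    by apply/funext => Y; rewrite poisson_coord2 mulrA.
  rewrite poissonMr; [|exact: polyfun_cst|apply: polyfunM; exact: polyfun_coord].
  rewrite poisson_cstr mulr0 addr0 poissonMr; [|exact: polyfun_coord..].
  by rewrite !poisson_coord2.
rewrite /jacobiator !E !rmorphD /=.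
pose s a b : K := (sgn_diff a b)%:~R.
have sC a b : s a b = - s b a by rewrite /s sgn_diffC rmorphN.
have sxx a : s a a = 0 by rewrite /s sgn_diffxx.
have scyc a b c : ~~ ((a == b) && (b == c)) ->
    s b a * s c b + s c b * s a c + s a c * s b a = - 1.
  by move=> /sgn_diff_cyclic e; rewrite /s -!rmorphM -!rmorphD /= e rmorphN.
rewrite -!/(s _ _).
rewrite (sC p i) (sC q j) (sC i k) (sC j l) (sC k p) (sC l q).
pose x a b := X a b; rewrite -!/(x _ _).
have [/andP[/eqP ik /eqP kp]|/scyc r] := boolP ((i == k :> nat) && (k == p :> nat)).
  have {}ik : i = k by exact: val_inj.
  have {}kp : k = p by exact: val_inj.
  by subst k p; rewrite sxx; ring.
have [/andP[/eqP jl /eqP lq]|/scyc r'] := boolP ((j == l :> nat) && (l == q :> nat)).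
  have {}jl : j = l by exact: val_inj.
  have {}lq : l = q by exact: val_inj.
  by subst l q; rewrite sxx; ring.
(* The jacobiator is the row cyclic sum minus the column cyclic sum, times a cubic. Both sums are
   now -1; in the two degenerate cases above the cubic itself vanishes. *)
transitivity ((s k i * s p k + s p k * s i p + s i p * s k i -
   (s l j * s q l + s q l * s j q + s j q * s l j)) *
   (x i q * x k j * x p l - x i l * x k q * x p j)).
  ring.
by rewrite r r' subrr mul0r.
Qed.

Lemma jacobi f g h X : polyfun f -> polyfun g -> polyfun h ->
  poisson f (poisson g h) X + poisson g (poisson h f) X +
  poisson h (poisson f g) X = 0.
Proof.
move=> pf pg ph.
apply: (jacobiator_generated pg ph) pf X => i j X.
have pij := polyfun_coord i j.
rewrite jacobiatorC; apply: (jacobiator_generated ph pij) pg X => k l X.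
have pkl := polyfun_coord k l.
rewrite jacobiatorC; apply: (jacobiator_generated pij pkl) ph X => p q X.
by rewrite jacobiatorC jacobi_coord.
Qed.

Lemma poisson_commuting_derivations f g h X :
  polyfun f -> polyfun g -> polyfun h -> (forall Y, poisson g h Y = 0) ->
  poisson (poisson f g) h X = poisson (poisson f h) g X.
Proof.
move=> pf pg ph gh0; have := jacobi X pf pg ph.
have -> : poisson g h = fun=> 0 by exact/funext.
rewrite poisson_cstr add0r.
have -> : poisson h f = fun Y => (fun=> -1) Y * poisson f h Y.
  by apply/funext => Y; rewrite mulN1r poissonC.
rewrite poissonMr; [|exact: polyfun_cst|exact: polyfun_poisson].
rewrite poisson_cstr mulr0 addr0 mulN1r -poissonC => /eqP; rewrite addr_eq0 => /eqP ->.
by rewrite -poissonC.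
Qed.

(** An integral curve is specified on coordinates; both sides obey the Leibniz rule in [f]. *)
Lemma cderiv_integral_curve H X0 gamma f t :
  integral_curve H X0 gamma -> polyfun f ->
  cderiv (f \o gamma) t (poisson f H (gamma t)).
Proof.
move=> [_ gD]; elim=> {f} [c|i j|f g pf df pg dg|f g pf df pg dg].
- by rewrite poisson_cstl; apply: cderiv_cst.
- by rewrite poissonE; apply: gD.
- by rewrite poissonDl //; apply: cderivD.
- rewrite poissonMl //; apply: cderiv_eq (cderivM df dg) _.
  by rewrite addrC [_ * g _]mulrC.
Qed.

End PolynomialFunctions.

(** * Minors and their flows *)

Section Minors.
Variables (R : realType) (n : nat).
Local Notation K := (Cplx R).

(** What the later arguments use of a minor, freed from the enumerations of [I] and [J]: the row and
    column fields are the adjugate identities, including their vanishing off-diagonal cases. *)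
Record minor_like (I J : {set 'I_n}) (F : 'M[K]_n -> K) : Prop := MinorLike {
  minor_polyfun : polyfun F;
  minor_support : forall (X : 'M[K]_n) k l, (k \notin I) || (l \notin J) ->
    partial_deriv k l F X = 0;
  minor_row : forall (X : 'M[K]_n) i k, i \in I ->
    \sum_(l < n) X i l * partial_deriv k l F X = F X *+ (i == k);
  minor_col : forall (X : 'M[K]_n) j l, j \in J ->
    \sum_(k < n) X k j * partial_deriv k l F X = F X *+ (j == l);
  minor_local : forall X Y : 'M[K]_n,
    (forall i j, i \in I -> j \in J -> X i j = Y i j) ->
    F X = F Y /\ forall k l, partial_deriv k l F X = partial_deriv k l F Y }.

Lemma cofactor_row_eq (m : nat) (A B : 'M[K]_m) (a b : 'I_m) :
  (forall i j, i != a -> A i j = B i j) -> cofactor A a b = cofactor B a b.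
Proof.
move=> AB; rewrite /cofactor; congr (_ * \det _).
by apply/matrixP => i j; rewrite !mxE AB // eq_sym neq_lift.
Qed.

(** Expand along row [a], whose cofactors do not involve that row. A minor is therefore affine in
    each entry, with the cofactor as slope. *)
Lemma det_add_delta (m : nat) (A : 'M[K]_m) (a b : 'I_m) (t : K) :
  \det (A + t *: delta_mx a b) = \det A + t * cofactor A a b.
Proof.
rewrite !(expand_det_row _ a).
under eq_bigr => j _.
  rewrite (@cofactor_row_eq _ _ A) => [|i k ia]; last first.
    by rewrite !mxE (negPf ia) mulr0 addr0.
  rewrite !mxE eqxx /= mulrDl.
  over.
rewrite big_split /=; congr (_ + _).
rewrite (bigD1 b) //= eqxx mulr1 big1 ?addr0 // => j /negPf jb.
by rewrite jb mulr0 mul0r.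
Qed.

Variables (I J : {set 'I_n}) (eIJ : #|I| = #|J|).
Let F : 'M[K]_n -> K := minor eIJ.
Let S (X : 'M[K]_n) : 'M[K]_#|I| :=
  \matrix_(a < #|I|, b < #|I|) X (enum_val a) (enum_val (cast_ord eIJ b)).

Lemma cast_enum_val_inj : injective (fun b => enum_val (cast_ord eIJ b) : 'I_n).
Proof. by move=> b b' /enum_val_inj/cast_ord_inj. Qed.

Lemma cast_enum_valP l : l \in J -> exists b, l = enum_val (cast_ord eIJ b).
Proof.
move=> lJ; exists (cast_ord (esym eIJ) (enum_rank_in lJ l)).
by rewrite cast_ordKV enum_rankK_in.
Qed.

Lemma enum_val_inP k : k \in I -> exists a : 'I_#|I|, k = enum_val a.
Proof. by move=> kI; exists (enum_rank_in kI k); rewrite enum_rankK_in. Qed.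

Lemma partial_deriv_minor0 X k l : (k \notin I) || (l \notin J) ->
  partial_deriv k l F X = 0.
Proof.
move=> kl; apply: partial_deriv_affine => t; rewrite mulr0 addr0 /F /minor.
congr (\det _); apply/matrixP => a b; rewrite !mxE.
case: eqP => [ak|_]; last by rewrite mulr0 add0r.
case: eqP => [bl|_]; last by rewrite mulr0 add0r.
by move: kl; rewrite -ak -bl !enum_valP.
Qed.

Lemma partial_deriv_minor X a b :
  partial_deriv (enum_val a) (enum_val (cast_ord eIJ b)) F X = cofactor (S X) a b.
Proof.
apply: partial_deriv_affine => t; rewrite -det_add_delta /F /minor.
congr (\det _); apply/matrixP => i j; rewrite !mxE addrC; congr (_ + t * (_ && _)%:R).
  by rewrite (inj_eq enum_val_inj).
by rewrite (inj_eq cast_enum_val_inj).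
Qed.

Lemma polyfun_minor : polyfun F.
Proof.
rewrite /F /minor /determinant; apply: polyfun_sum => s.
apply: polyfunM; first exact: polyfun_cst.
apply: polyfun_prod => a; apply: (polyfun_ext _ (polyfun_coord _ _ _)) => X.
by rewrite mxE.
Qed.

Lemma minor_likeP : minor_like I J F.
Proof.
split; [exact: polyfun_minor|exact: partial_deriv_minor0|..].
- move=> X i k iI; have [kI|kI] := boolP (k \in I); last first.
    rewrite big1 => [|l _]; last by rewrite partial_deriv_minor0 ?kI ?mulr0.
    by case: eqP => // ik; rewrite -ik iI in kI.
  have [[a ->] [c ->]] := (enum_val_inP iI, enum_val_inP kI).
  rewrite (bigID (mem J)) /= [X in _ + X]big1 ?addr0 => [|l lJ]; last first.
    by rewrite partial_deriv_minor0 ?lJ ?orbT ?mulr0.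
  rewrite big_enum_val /= (reindex (cast_ord eIJ)) /=; last first.
    by apply: onW_bij; exists (cast_ord (esym eIJ)); [exact: cast_ordK | exact: cast_ordKV].
  have := congr1 (fun M : 'M[K]_#|I| => M a c) (mul_mx_adj (S X)).
  rewrite !mxE (inj_eq enum_val_inj) => <-.
  by apply: eq_bigr => b _; rewrite partial_deriv_minor !mxE.
- move=> X j l jJ; have [lJ|lJ] := boolP (l \in J); last first.
    rewrite big1 => [|k _]; last by rewrite partial_deriv_minor0 ?lJ ?orbT ?mulr0.
    by case: eqP => // jl; rewrite -jl jJ in lJ.
  have [[b ->] [d ->]] := (cast_enum_valP jJ, cast_enum_valP lJ).
  rewrite (bigID (mem I)) /= [X in _ + X]big1 ?addr0 => [|k kI]; last first.
    by rewrite partial_deriv_minor0 ?kI ?mulr0.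
  rewrite big_enum_val /=.
  have := congr1 (fun M : 'M[K]_#|I| => M d b) (mul_adj_mx (S X)).
  rewrite !mxE (inj_eq cast_enum_val_inj) [b == d]eq_sym => <-.
  by apply: eq_bigr => a _; rewrite partial_deriv_minor !mxE mulrC.
- move=> X Y XY.
  have SXY : S X = S Y by apply/matrixP => a b; rewrite !mxE XY ?enum_valP.
  split; first by rewrite /F /minor -!/(S _) SXY.
  move=> k l; have [kl|] := boolP ((k \notin I) || (l \notin J)).
    by rewrite !partial_deriv_minor0.
  rewrite negb_or !negbK => /andP[/enum_val_inP[a ->] /cast_enum_valP[b ->]].
  by rewrite !partial_deriv_minor SXY.
Qed.

End Minors.

(** The gradient is transposed so that it multiplies [X] on both sides; for a minor it is the
    adjugate of the submatrix, padded with zeros. *)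
HB.lock Definition grad (R : realType) (n : nat) (F : 'M[Cplx R]_n -> Cplx R)
  (X : 'M[Cplx R]_n) : 'M[Cplx R]_n := \matrix_(l, k) partial_deriv k l F X.

(** * The explicit flow of a minor *)

Section MinorFlow.
Variables (R : realType) (n : nat).
Local Notation K := (Cplx R).
Local Notation M := ('M[K]_n).
Implicit Types (F : M -> K) (X Y : M).

Lemma gradE F X l k : grad F X l k = partial_deriv k l F X.
Proof. by rewrite grad.unlock mxE. Qed.

Definition ham_left F X : M :=
  \matrix_(i, k) ((sgn_diff k i)%:~R * (X *m grad F X) i k).

Definition ham_right F X : M :=
  \matrix_(l, j) ((sgn_diff l j)%:~R * (grad F X *m X) l j).

Lemma poisson_coord_ham i j F X :
  poisson (matrix_coord i j) F X =
  (ham_left F X *m X + X *m ham_right F X) i j.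
Proof.
rewrite poisson_coord !mxE.
transitivity (\sum_(k < n) \sum_(l < n) ((sgn_diff k i)%:~R * X i l * X k j *
     partial_deriv k l F X + (sgn_diff l j)%:~R * X i l * X k j *
     partial_deriv k l F X)).
  by do 2!apply: eq_bigr => ? _; rewrite rmorphD /= !mulrDl.
under eq_bigr do rewrite big_split; rewrite big_split /=; congr (_ + _).
  apply: eq_bigr => k _; rewrite !mxE mulr_sumr mulr_suml; apply: eq_bigr => l _.
  by rewrite gradE -!mulrA [X k j * _]mulrC.
rewrite exchange_big; apply: eq_bigr => l _ /=; rewrite !mxE !mulr_sumr.
apply: eq_bigr => k _; rewrite gradE -!mulrA mulrCA; congr (_ * (_ * _)).
by rewrite mulrC.
Qed.

(* [ham_left F] and [ham_right F] evolve along the flow of a minor [F] by the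
   scalars [exp (t s (F X))], with [s] the sign attached to the entry, and have
   square zero; their time integrals are [flow_left F t] and [flow_right F t]. *)
Definition flow_left F t X : M := \matrix_(i, k)
  ((sgn_diff k i)%:~R * cexpint t ((sgn_diff k i)%:~R * F X) *
   (X *m grad F X) i k).

Definition flow_right F t X : M := \matrix_(l, j)
  ((sgn_diff l j)%:~R * cexpint t ((sgn_diff l j)%:~R * F X) *
   (grad F X *m X) l j).

Definition flow F t X : M :=
  (1%:M + flow_left F t X) *m X *m (1%:M + flow_right F t X).

Lemma flow0 F X : flow F 0 X = X.
Proof.
have -> : flow F 0 X = (1%:M + 0) *m X *m (1%:M + 0).
  by congr (_ *m _ *m _); congr (_ + _); apply/matrixP => i j;
    rewrite !mxE cexpint0 mulr0 mul0r.
by rewrite addr0 mul1mx mulmx1.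
Qed.

Lemma cderiv_mulmx (A B : K -> M) (A' B' : M) (t : K) :
  (forall i j, cderiv (fun s => A s i j) t (A' i j)) ->
  (forall i j, cderiv (fun s => B s i j) t (B' i j)) ->
  forall i j, cderiv (fun s => (A s *m B s) i j) t
    ((A' *m B t + A t *m B') i j).
Proof.
move=> AD BD i j; rewrite !mxE -big_split /=.
apply: (@cderiv_ext _ (fun s => \sum_k A s i k * B s k j)).
  by move=> s; rewrite mxE.
by apply: cderiv_sum => k; apply: cderivM.
Qed.

Section MinorLike.
Variables (I J : {set 'I_n}) (F : M -> K).
Hypothesis FM : minor_like I J F.

Lemma grad_minor0 X l k : (k \notin I) || (l \notin J) -> grad F X l k = 0.
Proof. by move=> kl; rewrite gradE (minor_support FM). Qed.

Lemma mul_grad_minor X i k : i \in I -> (X *m grad F X) i k = F X *+ (i == k).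
Proof.
by move=> iI; rewrite mxE -(minor_row FM X k iI); apply: eq_bigr => l _; rewrite gradE.
Qed.

Lemma grad_mul_minor X l j : j \in J -> (grad F X *m X) l j = F X *+ (j == l).
Proof.
move=> jJ; rewrite mxE -(minor_col FM X l jJ).
by apply: eq_bigr => k _; rewrite gradE mulrC.
Qed.

(** In a row of [I] the matrix [X *m grad F X] has only its diagonal entry, which the sign of
    [i - i] kills; its columns outside [I] vanish with those of [grad F X]. The three analogues
    below hold likewise and yield the square-zero relations. *)
Let flow_left0 t X i k : (i \in I) || (k \notin I) -> flow_left F t X i k = 0.
Proof.
rewrite [LHS]mxE; have [iI _|iI /= kI] := boolP (i \in I).
  rewrite mul_grad_minor //; case: eqP => [->|_]; last by rewrite mulr0.
  by rewrite sgn_diffxx !mul0r.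
by rewrite [X in _ * X]mxE big1 ?mulr0 // => l _; rewrite grad_minor0 ?kI ?mulr0.
Qed.

Let ham_left0 X i k : (i \in I) || (k \notin I) -> ham_left F X i k = 0.
Proof.
rewrite [LHS]mxE; have [iI _|iI /= kI] := boolP (i \in I).
  rewrite mul_grad_minor //; case: eqP => [->|_]; last by rewrite mulr0.
  by rewrite sgn_diffxx !mul0r.
by rewrite [X in _ * X]mxE big1 ?mulr0 // => l _; rewrite grad_minor0 ?kI ?mulr0.
Qed.

Let flow_right0 t X l j : (l \notin J) || (j \in J) -> flow_right F t X l j = 0.
Proof.
rewrite [LHS]mxE; have [jJ _|jJ lJ] := boolP (j \in J).
  rewrite grad_mul_minor //; case: eqP => [->|_]; last by rewrite mulr0.
  by rewrite sgn_diffxx !mul0r.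
rewrite orbF in lJ.
by rewrite [X in _ * X]mxE big1 ?mulr0 // => k _; rewrite grad_minor0 ?lJ ?orbT ?mul0r.
Qed.

Let ham_right0 X l j : (l \notin J) || (j \in J) -> ham_right F X l j = 0.
Proof.
rewrite [LHS]mxE; have [jJ _|jJ lJ] := boolP (j \in J).
  rewrite grad_mul_minor //; case: eqP => [->|_]; last by rewrite mulr0.
  by rewrite sgn_diffxx !mul0r.
rewrite orbF in lJ.
by rewrite [X in _ * X]mxE big1 ?mulr0 // => k _; rewrite grad_minor0 ?lJ ?orbT ?mul0r.
Qed.

Let flow_block t X i j : i \in I -> j \in J -> flow F t X i j = X i j.
Proof.
move=> iI jJ; rewrite /flow mulmxDr mulmx1 mxE [X in _ + X]mxE.
rewrite [X in _ + X]big1 ?addr0 => [|l _]; last first.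
  by rewrite flow_right0 ?jJ ?orbT ?mulr0.
rewrite mulmxDl mul1mx mxE [X in _ + X]mxE big1 ?addr0 // => k _.
by rewrite flow_left0 ?iI ?mul0r.
Qed.

Lemma flow_invariant t X : F (flow F t X) = F X.
Proof. by have [] := minor_local FM (flow_block t X). Qed.

Let flow_grad t X : grad F (flow F t X) = grad F X.
Proof.
have [_ E] := minor_local FM (flow_block t X).
by apply/matrixP => l k; rewrite !gradE E.
Qed.

(** Since [flow_right] annihilates [grad F X] from the left, only the left factor of the flow acts.
    It multiplies an entry of sign [s] by [1 + s F cexpint t (s F)], which is [exp (t s F)]. *)
Let ham_left_flow t X i k :
  ham_left F (flow F t X) i k =
  (sgn_diff k i)%:~R * cexp (t * ((sgn_diff k i)%:~R * F X)) * (X *m grad F X) i k.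
Proof.
rewrite [LHS]mxE -mulrA flow_grad; congr (_ * _).
have -> : flow F t X *m grad F X = X *m grad F X + flow_left F t X *m (X *m grad F X).
  have -> : flow F t X *m grad F X =
      (1%:M + flow_left F t X) *m X *m (grad F X + flow_right F t X *m grad F X).
    by rewrite /flow -mulmxA [(1%:M + flow_right F t X) *m _]mulmxDl mul1mx.
  have -> : flow_right F t X *m grad F X = 0.
    apply/matrixP => l m; rewrite !mxE big1 // => j _.
    have [jJ|jJ] := boolP (j \in J); first by rewrite flow_right0 ?jJ ?orbT ?mul0r.
    by rewrite grad_minor0 ?jJ ?orbT ?mulr0.
  by rewrite addr0 -mulmxA mulmxDl mul1mx.
rewrite mxE; have -> : (flow_left F t X *m (X *m grad F X)) i k = flow_left F t X i k * F X.
  have [kI|kI] := boolP (k \in I); last first.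
    rewrite flow_left0 ?kI ?orbT // mul0r mxE big1 // => m _.
    by rewrite [X in _ * X]mxE big1 ?mulr0 // => l _; rewrite grad_minor0 ?kI ?mulr0.
  rewrite mxE (bigD1 k) //= mul_grad_minor // eqxx [X in _ + X]big1 ?addr0 // => m mk.
  have [mI|mI] := boolP (m \in I); first by rewrite mul_grad_minor // (negPf mk) mulr0.
  by rewrite flow_left0 ?mI ?orbT ?mul0r.
rewrite [flow_left _ _ _ _ _]mxE.
have := cexpintE t ((sgn_diff k i)%:~R * F X) => /eqP; rewrite eq_sym subr_eq => /eqP ->.
by set a := _%:~R; set b := cexpint _ _; set c := fun_of_matrix _ _ _; ring.
Qed.

Let ham_right_flow t X l j :
  ham_right F (flow F t X) l j =
  (sgn_diff l j)%:~R * cexp (t * ((sgn_diff l j)%:~R * F X)) * (grad F X *m X) l j.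
Proof.
rewrite [LHS]mxE -mulrA flow_grad; congr (_ * _).
have -> : grad F X *m flow F t X = grad F X *m X + (grad F X *m X) *m flow_right F t X.
  have -> : grad F X *m flow F t X =
      (grad F X + grad F X *m flow_left F t X) *m X *m (1%:M + flow_right F t X).
    by rewrite /flow !mulmxA [grad F X *m (1%:M + _)]mulmxDr mulmx1.
  have -> : grad F X *m flow_left F t X = 0.
    apply/matrixP => a b; rewrite !mxE big1 // => k _.
    have [kI|kI] := boolP (k \in I); first by rewrite flow_left0 ?kI ?mulr0.
    by rewrite grad_minor0 ?kI ?mul0r.
  by rewrite addr0 mulmxDr mulmx1.
rewrite mxE; have -> : ((grad F X *m X) *m flow_right F t X) l j = F X * flow_right F t X l j.
  have [lJ|lJ] := boolP (l \in J); last first.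
    rewrite flow_right0 ?lJ // mulr0 mxE big1 // => m _.
    by rewrite [X in X * _]mxE big1 ?mul0r // => k _; rewrite grad_minor0 ?lJ ?orbT ?mul0r.
  rewrite mxE (bigD1 l) //= grad_mul_minor // eqxx [X in _ + X]big1 ?addr0 // => m ml.
  have [mJ|mJ] := boolP (m \in J); first by rewrite grad_mul_minor // (negPf ml) mul0r.
  by rewrite flow_right0 ?mJ ?mulr0.
rewrite [flow_right _ _ _ _ _]mxE.
have := cexpintE t ((sgn_diff l j)%:~R * F X) => /eqP; rewrite eq_sym subr_eq => /eqP ->.
by set a := _%:~R; set b := cexpint _ _; set c := fun_of_matrix _ _ _; ring.
Qed.

Lemma integral_curve_flow X : integral_curve F X (fun t => flow F t X).
Proof.
split=> [|t i j]; first exact: flow0.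
rewrite -poissonE poisson_coord_ham -/(cderiv _ _ _).
have LD a b : cderiv (fun s => (1%:M + flow_left F s X) a b) t
    (ham_left F (flow F t X) a b).
  rewrite ham_left_flow.
  apply: (@cderiv_ext _ (fun s => (1%:M : M) a b + (sgn_diff b a)%:~R *
      cexpint s ((sgn_diff b a)%:~R * F X) * (X *m grad F X) a b)).
    by move=> s; rewrite [RHS]mxE [flow_left _ _ _ _ _]mxE.
  apply: cderiv_eq (cderivD (cderiv_cst _ t) (cderivM (cderivZ _ (cderiv_cexpint t _))
    (cderiv_cst _ t))) _.
  by rewrite add0r mulr0 addr0.
have RD a b : cderiv (fun s => (1%:M + flow_right F s X) a b) t
    (ham_right F (flow F t X) a b).
  rewrite ham_right_flow.
  apply: (@cderiv_ext _ (fun s => (1%:M : M) a b + (sgn_diff a b)%:~R *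
      cexpint s ((sgn_diff a b)%:~R * F X) * (grad F X *m X) a b)).
    by move=> s; rewrite [RHS]mxE [flow_right _ _ _ _ _]mxE.
  apply: cderiv_eq (cderivD (cderiv_cst _ t) (cderivM (cderivZ _ (cderiv_cexpint t _))
    (cderiv_cst _ t))) _.
  by rewrite add0r mulr0 addr0.
have XD a b : cderiv (fun=> X a b) t ((0 : M) a b) by rewrite mxE; exact: cderiv_cst.
move: LD RD (@ham_left0 (flow F t X)) (@ham_right0 (flow F t X)).
move: (ham_left _ _) (ham_right _ _) => HL HR LD RD HL0 HR0.
(* The factor [1 + flow_left] can be inserted after [HL] because [HL *m flow_left] vanishes: columns
   in [I] meet rows outside [I]. *)
have EL : HL *m X *m (1%:M + flow_right F t X) = HL *m flow F t X.
  rewrite /flow !mulmxA [HL *m (1%:M + _)]mulmxDr mulmx1.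
  have -> : HL *m flow_left F t X = 0.
    apply/matrixP => a b; rewrite !mxE big1 // => k _.
    have [kI|kI] := boolP (k \in I); first by rewrite flow_left0 ?kI ?mulr0.
    by rewrite HL0 ?kI ?orbT ?mul0r.
  by rewrite addr0.
have ER : (1%:M + flow_left F t X) *m X *m HR = flow F t X *m HR.
  rewrite /flow -[RHS]mulmxA [(1%:M + flow_right _ _ _) *m _]mulmxDl mul1mx.
  have -> : flow_right F t X *m HR = 0.
    apply/matrixP => a b; rewrite !mxE big1 // => k _.
    have [kJ|kJ] := boolP (k \in J); first by rewrite flow_right0 ?kJ ?orbT ?mul0r.
    by rewrite HR0 ?kJ ?mulr0.
  by rewrite addr0.
have := cderiv_mulmx (cderiv_mulmx LD XD) RD i j.
by rewrite mulmx0 addr0 EL ER.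
Qed.

End MinorLike.
End MinorFlow.

(** * Vanishing of the bracket of two separated minors *)

Section SeparatedMinors.
Variables (R : realType) (n : nat).
Local Notation K := (Cplx R).
Local Notation M := ('M[K]_n).

Lemma poisson_grad (F G : M -> K) (X : M) :
  poisson F G X =
  \sum_(i < n) \sum_(k < n) (sgn_diff k i)%:~R *
    ((X *m grad F X) k i * (X *m grad G X) i k) +
  \sum_(j < n) \sum_(l < n) (sgn_diff l j)%:~R *
    ((grad F X *m X) j l * (grad G X *m X) l j).
Proof.
have mE (A B : M) a b : (A *m B) a b = \sum_(c < n) A a c * B c b by rewrite mxE.
rewrite poissonE /pbracket.
transitivity (\sum_(i < n) \sum_(k < n) \sum_(j < n) \sum_(l < n)
   ((sgn_diff k i)%:~R * ((X k j * grad F X j i) * (X i l * grad G X l k)) +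
    (sgn_diff l j)%:~R * ((grad F X j i * X i l) * (grad G X l k * X k j)))).
  have alg (s s' x y a b : K) : (s + s') * x * y * (a * b) =
      s * ((y * a) * (x * b)) + s' * ((a * x) * (b * y)) by ring.
  apply: eq_bigr => i _; apply: eq_bigr => k _.
  apply: eq_bigr => j _; apply: eq_bigr => l _.
  by rewrite (gradE F) (gradE G) rmorphD; exact: alg.
under eq_bigr => i _ do under eq_bigr => k _ do under eq_bigr => j _ do rewrite big_split.
under eq_bigr => i _ do under eq_bigr => k _ do rewrite big_split.
under eq_bigr => i _ do rewrite big_split.
rewrite big_split /=; congr (_ + _).
  apply: eq_bigr => i _; apply: eq_bigr => k _.
  rewrite (mE X (grad F X)) (mE X (grad G X)) big_distrlr /=.
  by rewrite mulr_sumr; apply: eq_bigr => j _; rewrite mulr_sumr.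
under eq_bigr => i _ do rewrite exchange_big.
rewrite exchange_big; apply: eq_bigr => j _ /=.
under eq_bigr => i _ do rewrite exchange_big.
rewrite exchange_big; apply: eq_bigr => l _ /=.
rewrite (mE (grad F X) X) (mE (grad G X) X) big_distrlr /=.
by rewrite mulr_sumr; apply: eq_bigr => j' _; rewrite mulr_sumr.
Qed.

Variables (I J I' J' : {set 'I_n}) (F G : M -> K).
Hypotheses (FM : minor_like I J F) (GM : minor_like I' J' G).
Hypothesis rows : forall i k, i \in I :\: I' -> k \in I' :\: I -> (k < i)%N.
Hypothesis cols : forall j l, j \in J :\: J' -> l \in J' :\: J -> (j < l)%N.
Hypothesis card_meet : #|I :&: I'| = #|J :&: J'|.

Lemma poisson_separated X : poisson F G X = 0.
Proof.
have sum_meet (A : {set 'I_n}) (c : K) :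
    \sum_(i < n) \sum_(k < n) c *+ ((i == k) && (i \in A)) = c *+ #|A|.
  under eq_bigr => i _.
    rewrite (bigD1 i) //= eqxx /= big1 ?addr0 => [|k ki]; last first.
      by rewrite eq_sym (negPf ki).
    over.
  rewrite -sumr_const [RHS]big_mkcond /=; apply: eq_bigr => i _.
  by case: (i \in A).
rewrite poisson_grad.
(* Off the diagonal a nonzero row term has [i] in [I] minus [I'] and [k] in [I'] minus [I], so its
   sign is -1; column terms have sign +1. On the diagonal the true sign is 0, and the added terms
   [F X * G X] compensate for the constant sign. *)
transitivity (\sum_(i < n) \sum_(k < n) (- ((X *m grad F X) k i * (X *m grad G X) i k) +
      (F X * G X) *+ ((i == k) && (i \in I :&: I'))) +
    \sum_(j < n) \sum_(l < n) ((grad F X *m X) j l * (grad G X *m X) l j -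
      (F X * G X) *+ ((j == l) && (j \in J :&: J')))).
  congr (_ + _); apply: eq_bigr => i _; apply: eq_bigr => k _; rewrite inE.
  - have Fki : i \notin I -> (X *m grad F X) k i = 0.
      move=> iI; rewrite mxE big1 // => l _.
      by rewrite (grad_minor0 FM) ?iI ?mulr0.
    have Gik : k \notin I' -> (X *m grad G X) i k = 0.
      move=> kI; rewrite mxE big1 // => l _.
      by rewrite (grad_minor0 GM) ?kI ?mulr0.
    have [iI|iI] := boolP (i \in I); last by rewrite Fki // andbF !(mul0r, mulr0) oppr0 addr0.
    have [kI'|kI'] := boolP (k \in I'); last first.
      rewrite Gik // !mulr0 oppr0 add0r; case: eqP => [ik|_] //=.
      by rewrite ik (negPf kI').
    have [kI|kI] := boolP (k \in I).
      rewrite (mul_grad_minor FM _ _ kI); case: eqVneq => [ki|_]; last first.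
        by rewrite /= mulr0n !mul0r mulr0 oppr0 addr0.
      rewrite -ki kI' (mul_grad_minor GM _ _ kI') eqxx sgn_diffxx mul0r.
      by rewrite !mulr1n addNr.
    have ik : i != k by apply: contraNneq kI => <-.
    rewrite (negPf ik) /= addr0; have [iI'|iI'] := boolP (i \in I').
      by rewrite (mul_grad_minor GM _ _ iI') (negPf ik) !mulr0 oppr0.
    have ki : (k < i)%N by apply: rows; rewrite inE ?iI' ?kI.
    by rewrite sgn_diffE ki ltnNge (ltnW ki) sub0r mulrNz mulN1r.
  - have Fik : i \notin J -> (grad F X *m X) i k = 0.
      move=> iJ; rewrite mxE big1 // => l _.
      by rewrite (grad_minor0 FM) ?iJ ?orbT ?mul0r.
    have Gki : k \notin J' -> (grad G X *m X) k i = 0.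
      move=> kJ; rewrite mxE big1 // => l _.
      by rewrite (grad_minor0 GM) ?kJ ?orbT ?mul0r.
    have [iJ|iJ] := boolP (i \in J); last by rewrite Fik // andbF !(mul0r, mulr0) subr0.
    have [kJ'|kJ'] := boolP (k \in J'); last first.
      rewrite Gki // !mulr0 sub0r; case: eqP => [ik|_] /=; last by rewrite oppr0.
      by rewrite ik (negPf kJ') oppr0.
    have [kJ|kJ] := boolP (k \in J).
      rewrite (grad_mul_minor FM _ _ kJ); case: eqVneq => [ki|_]; last first.
        by rewrite /= mulr0n !mul0r mulr0 subr0.
      rewrite -ki kJ' (grad_mul_minor GM _ _ kJ') eqxx sgn_diffxx mul0r.
      by rewrite !mulr1n subrr.
    have ik : i != k by apply: contraNneq kJ => <-.
    rewrite (negPf ik) /= subr0; have [iJ'|iJ'] := boolP (i \in J').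
      by rewrite (grad_mul_minor GM _ _ iJ') (negPf ik) !mulr0.
    have ki : (i < k)%N by apply: cols; rewrite inE ?iJ' ?kJ.
    by rewrite sgn_diffE ki ltnNge (ltnW ki) subr0 mul1r.
under eq_bigr do rewrite big_split; rewrite big_split /= sum_meet.
under [X in _ + X]eq_bigr do rewrite sumrB; rewrite sumrB sum_meet card_meet.
rewrite addrACA subrr addr0.
under eq_bigr do rewrite sumrN; rewrite sumrN addrC; apply/eqP; rewrite subr_eq0; apply/eqP.
(* The corrections have cancelled by [card_meet]; the two remaining double sums are equal traces by
   cyclicity. *)
transitivity (\tr (grad F X *m X *m (grad G X *m X))).
  by apply: eq_bigr => j _; rewrite [RHS]mxE.
rewrite -mulmxA mxtrace_mulC -!mulmxA mulmxA exchange_big.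
by rewrite mxtrace_mulC; apply: eq_bigr => k _; rewrite [LHS]mxE.
Qed.

End SeparatedMinors.

(** * Group law and commutation of the flows *)

Section FlowCommutation.
Variables (R : realType) (n : nat).
Local Notation K := (Cplx R).
Local Notation M := ('M[K]_n).
Implicit Types (F G : M -> K) (X Y : M).

(** The successive derivatives of [f] are carried as a sequence [y], the form in which
    [ode5_solution] takes them. *)
Definition ode5 (d : K) (f : K -> K) : Prop :=
  exists y : nat -> K -> K, [/\ y 0%N =1 f,
    forall k s, cderiv (y k) s (y k.+1 s) &
    forall s, y 5%N s = 5 * d ^+ 2 * y 3%N s - 4 * d ^+ 4 * y 1%N s].

Lemma ode5_ext d f g : f =1 g -> ode5 d f -> ode5 d g.
Proof. by move=> /funext ->. Qed.

Lemma ode5D d f g : ode5 d f -> ode5 d g -> ode5 d (fun s => f s + g s).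
Proof.
move=> [y [y0 yD y5]] [z [z0 zD z5]]; exists (fun k s => y k s + z k s); split.
- by move=> s; rewrite y0 z0.
- by move=> k s; apply: cderivD.
- by move=> s; rewrite y5 z5; ring.
Qed.

Lemma ode5_sum (I : Type) (r : seq I) d (f : I -> K -> K) :
  (forall i, ode5 d (f i)) -> ode5 d (fun s => \sum_(i <- r) f i s).
Proof.
move=> fO; elim: r => [|i r IH].
  exists (fun _ _ => 0); split.
  - by move=> s; rewrite big_nil.
  - by move=> k s; apply: cderiv_cst.
  - by move=> s; rewrite !mulr0 subrr.
by apply: (ode5_ext _ (ode5D (fO i) IH)) => s; rewrite big_cons.
Qed.

(** The exponents that occur are 0, [u d], [v d] and [(u + v) d], all among 0, [d], [-d], [2 d],
    [-2 d]. The prefactors [u] and [v] remove the terms linear in [t] that a zero sign would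
    bring. *)
Lemma ode5_cexpint d (u v a b c e : K) : u \in [:: 0; 1; - 1] -> v \in [:: 0; 1; - 1] ->
  ode5 d (fun t => a + u * b * cexpint t (u * d) + v * c * cexpint t (v * d) +
    u * v * e * (cexpint t (u * d) * cexpint t (v * d))).
Proof.
move=> uP vP.
(* [fun t => cexpint t p] has derivative [1 + p * cexpint t p], hence the span
   of [1], the two functions [cexpint] and their product is stable under differentiation. *)
pose step (w : K * K * K * K) := let: (a, b, c, e) := w in
  (b + c, u * d * b + e, v * d * c + e, (u + v) * d * e).
pose ev (w : K * K * K * K) t := let: (a, b, c, e) := w in
  a + b * cexpint t (u * d) + c * cexpint t (v * d) +
  e * (cexpint t (u * d) * cexpint t (v * d)).
exists (fun k => ev (iter k step (a, u * b, v * c, u * v * e))); split => //.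
  move=> k s; rewrite iterS; case: (iter k _ _) => [[[a' b'] c'] e'] /=.
  have D p : cderiv (fun t => cexpint t p) s (1 + p * cexpint s p).
    by apply: cderiv_eq (cderiv_cexpint s p) _; rewrite cexpintE addrC subrK.
  apply: cderiv_eq (cderivD (cderivD (cderivD (cderiv_cst a' s) (cderivZ b' (D _)))
    (cderivZ c' (D _))) (cderivZ e' (cderivM (D _) (D _)))) _.
  by move: (cexpint _ _) (cexpint _ _) => x y; ring.
move=> s; rewrite /ev /step /=.
move: (cexpint _ _) (cexpint _ _) => x y.
move: uP vP; rewrite !inE.
by case/or3P=> /eqP ->; case/or3P=> /eqP ->; ring.
Qed.

Lemma sgn_diff_in (a b : nat) : ((sgn_diff a b)%:~R : K) \in [:: 0; 1; - 1].
Proof.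
by rewrite sgn_diffE; case: ltngtP => _; rewrite !inE ?eqxx ?orbT.
Qed.

Lemma ode5_flow F X i j : ode5 (F X) (fun t => flow F t X i j).
Proof.
pose s (a b : nat) : K := (sgn_diff a b)%:~R.
pose A i k := (X *m grad F X) i k; pose B l j := (grad F X *m X) l j.
have LE t a b : (1%:M + flow_left F t X) a b =
    (1%:M : M) a b + s b a * cexpint t (s b a * F X) * A a b.
  by rewrite mxE [flow_left _ _ _ _ _]mxE.
have RE t a b : (1%:M + flow_right F t X) a b =
    (1%:M : M) a b + s a b * cexpint t (s a b * F X) * B a b.
  by rewrite mxE [flow_right _ _ _ _ _]mxE.
apply: (@ode5_ext _ (fun t => \sum_(l < n) \sum_(k < n)
  ((1%:M : M) i k * X k l * (1%:M : M) l j +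
   s k i * (A i k * X k l * (1%:M : M) l j) * cexpint t (s k i * F X) +
   s l j * ((1%:M : M) i k * X k l * B l j) * cexpint t (s l j * F X) +
   s k i * s l j * (A i k * X k l * B l j) *
     (cexpint t (s k i * F X) * cexpint t (s l j * F X))))).
  move=> t; rewrite [RHS]mxE; apply: eq_bigr => l _.
  rewrite [X in _ = X * _]mxE mulr_suml; apply: eq_bigr => k _.
  rewrite LE RE.
  move: ((1%:M : M) i k) ((1%:M : M) l j) (X k l) (A i k) (B l j) => a b x p q.
  set f := cexpint t (s k i * _); set g := cexpint t (s l j * _); ring.
apply: ode5_sum => l; apply: ode5_sum => k.
by apply: ode5_cexpint; apply: sgn_diff_in.
Qed.

Lemma polyfun_iter_poisson F p k : polyfun F -> polyfun p ->
  polyfun (iter k (fun p => poisson p F) p).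
Proof. by move=> pF pp; elim: k => //= k IH; apply: polyfun_poisson. Qed.

(** With [D = {-, F}], this is [D (D^2 - F^2) (D^2 - 4 F^2) p = 0], expanded. *)
Definition annihilated F (p : M -> K) : Prop := forall X,
  iter 5 (fun p => poisson p F) p X = 5 * F X ^+ 2 * iter 3 (fun p => poisson p F) p X -
    4 * F X ^+ 4 * iter 1 (fun p => poisson p F) p X.

Section OneFlow.
Variables (I J : {set 'I_n}) (F : M -> K).
Hypothesis FM : minor_like I J F.
Let pF : polyfun F := minor_polyfun FM.

Lemma cderiv_iter_poisson p k X t : polyfun p ->
  cderiv (fun t => iter k (fun p => poisson p F) p (flow F t X)) t
    (iter k.+1 (fun p => poisson p F) p (flow F t X)).
Proof.
move=> pp; rewrite iterS.
apply: (cderiv_integral_curve t (integral_curve_flow FM X)).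
exact: polyfun_iter_poisson.
Qed.

(** Along the flow, iterated brackets are successive time derivatives; the differential equation of
    the explicit flow is read off at time 0. *)
Lemma annihilated_coord i j : annihilated F (matrix_coord i j).
Proof.
move=> X; have [y [y0 yD y5]] := ode5_flow F X i j.
pose z k t := iter k (fun p => poisson p F) (matrix_coord i j) (flow F t X).
have zD k t : cderiv (z k) t (z k.+1 t).
  exact/cderiv_iter_poisson/polyfun_coord.
have yz k : y k =1 z k.
  elim: k => [|k IH] t; first by rewrite y0.
  apply: cderiv_unique (yD k t) _.
  by apply: cderiv_ext (zD k t) => s; rewrite IH.
by have := y5 0; rewrite !yz /z !flow0.
Qed.

(** The coefficients are chosen before [p] and [X]: they depend on the time and on the value [d] of
    [F] alone, which permits comparing expansions at different points. *)
Lemma flow_expansion d t : exists b : nat -> K, forall p X,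
  polyfun p -> annihilated F p -> F X = d ->
  forall s, p (flow F (s + t) X) =
    \sum_(m < 5) b m * iter m (fun p => poisson p F) p (flow F s X).
Proof.
have [b bP] := ode5_solution d t; exists b => p X pp pA FX s.
pose y k u := iter k (fun p => poisson p F) p (flow F (s + u) X).
have yD k u : cderiv (y k) u (y k.+1 u).
  rewrite -[y k.+1 u]mulr1; apply: (cderiv_comp (cderiv_iter_poisson _ _ _ pp)).
  apply: cderiv_eq (cderivD (cderiv_cst s u) (cderiv_id u)) _.
  by rewrite add0r.
have := bP y yD; rewrite /y /= addr0; apply => u.
by have := pA (flow F (s + u) X); rewrite (flow_invariant FM) FX.
Qed.

(** As [F] is conserved, both sides expand at [flow F s X] with the same coefficients. *)
Lemma flow_add s t X : flow F (s + t) X = flow F t (flow F s X).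
Proof.
apply/matrixP => i j; have [b bP] := flow_expansion (F X) t.
have px := polyfun_coord R i j; have xA := annihilated_coord i j.
have := bP _ _ px xA (erefl (F X)) s; rewrite /matrix_coord => ->.
have := bP _ _ px xA (flow_invariant FM s X) 0.
by rewrite /matrix_coord add0r flow0 => ->.
Qed.

End OneFlow.

Section TwoFlows.
Variables (I J I' J' : {set 'I_n}) (F G : M -> K).
Hypotheses (FM : minor_like I J F) (GM : minor_like I' J' G).
Hypothesis FG : forall X, poisson F G X = 0.
Let pF : polyfun F := minor_polyfun FM.
Let pG : polyfun G := minor_polyfun GM.

Let GF X : poisson G F X = 0.
Proof. by rewrite poissonC FG oppr0. Qed.

Lemma flow_preserves t X : F (flow G t X) = F X.
Proof.
rewrite -[in RHS](flow0 G X).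
apply: (@cderiv0_constant _ (fun t => F (flow G t X))) => s.
rewrite -[0](FG (flow G s X)).
by apply: (cderiv_integral_curve s (integral_curve_flow GM X)).
Qed.

Lemma iter_poissonC p k m X : polyfun p ->
  iter k (fun p => poisson p F) (iter m (fun p => poisson p G) p) X =
  iter m (fun p => poisson p G) (iter k (fun p => poisson p F) p) X.
Proof.
move=> pp; elim: k X => [//|k IH] X.
have -> : iter k.+1 (fun p => poisson p F) (iter m (fun p => poisson p G) p) =
    poisson (iter m (fun p => poisson p G) (iter k (fun p => poisson p F) p)) F.
  by rewrite iterS; congr poisson; apply/funext.
rewrite iterS; have := polyfun_iter_poisson k pF pp.
move: (iter k _ p) => q pq; elim: m X {IH} => [//|m IH] X.
rewrite !iterS -poisson_commuting_derivations //; last exact: polyfun_iter_poisson.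
by congr poisson; apply/funext.
Qed.

(** Bracketing with [F] commutes with bracketing with [G] and kills the coefficients, which are
    polynomials in [G]. *)
Lemma annihilated_poisson p : polyfun p -> annihilated G p ->
  annihilated G (poisson p F).
Proof.
move=> pp pA X.
have E m : iter m (fun p => poisson p G) (poisson p F) =
    poisson (iter m (fun p => poisson p G) p) F.
  by apply/funext => Y; rewrite -(iter_poissonC 1).
rewrite !E.
have -> : iter 5 (fun p => poisson p G) p = fun X =>
    (5 * (G X * G X)) * iter 3 (fun p => poisson p G) p X +
    (- 4 * ((G X * G X) * (G X * G X))) * iter 1 (fun p => poisson p G) p X.
  by apply/funext => Y; rewrite pA; move: (iter _ _ _ _) (iter _ _ _ _) => a b; ring.
have pG2 := polyfunM pG pG; have pG4 := polyfunM pG2 pG2.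
have p3 := polyfun_iter_poisson 3 pG pp; have p1 := polyfun_iter_poisson 1 pG pp.
have c5 := polyfunM (polyfun_cst _ 5) pG2.
have c4 := polyfunM (polyfun_cst _ (- 4)) pG4.
rewrite (poissonDl _ _ (polyfunM c5 p3) (polyfunM c4 p1)).
rewrite (poissonMl _ _ c5 p3) (poissonMl _ _ c4 p1).
rewrite (poissonMl _ _ (polyfun_cst _ 5) pG2) (poissonMl _ _ (polyfun_cst _ (- 4)) pG4).
rewrite (poissonMl _ _ pG2 pG2) (poissonMl _ _ pG pG) !poisson_cstl GF.
rewrite !mulr0 !addr0 !mulr0 !addr0.
move: (poisson _ _ _) (poisson _ _ _) => a b; ring.
Qed.

Lemma annihilated_iter_poisson p k : polyfun p -> annihilated G p ->
  annihilated G (iter k (fun p => poisson p F) p).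
Proof.
move=> pp pA; elim: k => // k IH; apply: annihilated_poisson => //.
exact: polyfun_iter_poisson.
Qed.

End TwoFlows.

Lemma flow_commute (I J I' J' : {set 'I_n}) F G s t X :
  minor_like I J F -> minor_like I' J' G -> (forall Y, poisson F G Y = 0) ->
  flow F s (flow G t X) = flow G t (flow F s X).
Proof.
move=> FM GM FG; have GF Y : poisson G F Y = 0 by rewrite poissonC FG oppr0.
have [pF pG] := (minor_polyfun FM, minor_polyfun GM).
apply/matrixP => i j; have px := polyfun_coord R i j.
have [a aP] := flow_expansion FM (F X) s.
have [b bP] := flow_expansion GM (G X) t.
transitivity (\sum_(k < 5) \sum_(m < 5) a k * b m *
    iter m (fun p => poisson p G) (iter k (fun p => poisson p F) (matrix_coord i j)) X).
  (* The coefficients [a], chosen for the value [F X], apply at [flow G t X] because the flow of [G]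
     conserves [F]. *)
  have := aP _ _ px (annihilated_coord FM i j) (flow_preserves FM GM FG t X) 0.
  rewrite add0r flow0 {1}/matrix_coord => ->; apply: eq_bigr => k _.
  have := bP _ _ (polyfun_iter_poisson k pF px)
    (annihilated_iter_poisson FM GM FG k px (annihilated_coord GM i j)) (erefl _) 0.
  rewrite add0r flow0 => ->; rewrite mulr_sumr; apply: eq_bigr => m _.
  by rewrite mulrA.
have := bP _ _ px (annihilated_coord GM i j) (flow_preserves GM FM GF s X) 0.
rewrite add0r flow0 {1}/matrix_coord => ->; rewrite exchange_big; apply: eq_bigr => m _.
have := aP _ _ (polyfun_iter_poisson m pG px)
    (annihilated_iter_poisson GM FM GF m px (annihilated_coord FM i j)) (erefl _) 0.
rewrite add0r flow0 => ->; rewrite mulr_sumr; apply: eq_bigr => k _.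
by rewrite mulrA [b m * _]mulrC (iter_poissonC FM GM FG).
Qed.

End FlowCommutation.

(** * The joint flow *)

Section Differentiability.
Variables (R : realType) (n : nat).
Local Notation K := (Cplx R).
Local Notation M := ('M[K]_n).
Variable W : normedModType K.

Lemma differentiable_entries (f : W -> M) (w : W) :
  (forall i j, differentiable (fun x => f x i j : K^o) w) -> differentiable f w.
Proof.
move=> fD.
have -> : f = fun x => (\sum_(i < n) fun x =>
    (\sum_(j < n) fun x => f x i j *: (delta_mx i j : M)) x) x.
  apply/funext => x; rewrite {1}[f x]matrix_sum_delta fct_sumE.
  by apply: eq_bigr => i _; rewrite fct_sumE.
apply: differentiable_sum => i; apply: differentiable_sum => j.
exact: (@differentiableZl _ _ _ (fun x => f x i j : K^o)).
Qed.

Lemma differentiable_entry (f : W -> M) (w : W) i j :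
  differentiable f w -> differentiable (fun x => f x i j : K^o) w.
Proof.
move=> fD; apply: (@differentiable_comp _ _ _ _ f (fun A : M => A i j : K^o)) => //.
exact: differentiable_coord.
Qed.

Lemma differentiable_mulmx (f g : W -> M) (w : W) :
  differentiable f w -> differentiable g w ->
  differentiable (fun x => f x *m g x) w.
Proof.
move=> fD gD; apply: differentiable_entries => i j.
have -> : (fun x => (f x *m g x) i j : K^o) =
    \sum_(k < n) (fun x => f x i k : K^o) * (fun x => g x k j : K^o).
  by apply/funext => x; rewrite mxE fct_sumE.
apply: differentiable_sum => k.
by apply: differentiableM; apply: differentiable_entry.
Qed.

(** Joint differentiability follows from a one-variable entire function, because [d] enters only
    through the product [a * d]. *)
Lemma differentiable_cexpint (a d : W -> K^o) (w : W) :
  differentiable a w -> differentiable d w ->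
  differentiable (fun x => cexpint (a x) (d x) : K^o) w.
Proof.
move=> aD dD; apply: (@differentiableM _ _ a (fun x => cexp1 (a x * d x) : K^o)) => //.
apply: (@differentiable_comp _ _ _ _ (a * d) (@cexp1 R : K^o -> K^o)).
  exact: differentiableM.
exact: differentiable_cexp1.
Qed.

Lemma differentiable_flow (F : M -> K) (a : W -> K^o) (g : W -> M) (w : W) :
  polyfun F -> differentiable a w -> differentiable g w ->
  differentiable (fun x => flow F (a x) (g x)) w.
Proof.
move=> pF aD gD.
have FD : differentiable (fun x => F (g x) : K^o) w.
  apply: (@differentiable_comp _ _ _ _ g (F : M -> K^o)) => //.
  exact: differentiable_polyfun.
have GD : differentiable (fun x => grad F (g x)) w.
  apply: differentiable_entries => i j.
  have -> : (fun x => grad F (g x) i j : K^o) =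
      (partial_deriv j i F : M -> K^o) \o g by apply/funext => x; rewrite gradE.
  apply: differentiable_comp => //; apply: differentiable_polyfun.
  exact: polyfun_partial_deriv.
have ED (s : K) (A : W -> M) i j : differentiable A w ->
    differentiable (fun x => s * cexpint (a x) (s * F (g x)) * A x i j : K^o) w.
  move=> AD; apply: (@differentiableM _ _
    (fun x => s * cexpint (a x) (s * F (g x)) : K^o) (fun x => A x i j : K^o)).
    apply: (@differentiableZ _ _ _ (fun x => cexpint (a x) (s * F (g x)) : K^o)).
    apply: differentiable_cexpint => //.
    exact: (@differentiableZ _ _ _ (fun x => F (g x) : K^o)).
  exact: differentiable_entry.
have LD : differentiable (fun x => flow_left F (a x) (g x)) w.
  apply: differentiable_entries => i j.
  under eq_fun do rewrite [flow_left _ _ _ _ _]mxE.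
  exact: (ED _ (fun x => g x *m grad F (g x)) i j (differentiable_mulmx gD GD)).
have RD : differentiable (fun x => flow_right F (a x) (g x)) w.
  apply: differentiable_entries => i j.
  under eq_fun do rewrite [flow_right _ _ _ _ _]mxE.
  exact: (ED _ (fun x => grad F (g x) *m g x) i j (differentiable_mulmx GD gD)).
have addD (A : W -> M) : differentiable A w -> differentiable (fun x => 1%:M + A x) w.
  by move=> AD; apply: (@differentiableD _ _ _ (cst (1%:M : M)) A).
exact: (differentiable_mulmx (differentiable_mulmx (addD _ LD) gD) (addD _ RD)).
Qed.

End Differentiability.

Section JointFlow.
Variables (R : realType) (n N : nat).
Local Notation K := (Cplx R).
Local Notation M := ('M[K]_n).
Variable H : 'I_N -> M -> K.
Hypothesis HM : forall k, exists I J, minor_like I J (H k).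
Hypothesis HH : forall k l X, poisson (H k) (H l) X = 0.

Definition joint_flow (s : seq 'I_N) (z : 'rV[K]_N) (X : M) : M :=
  foldr (fun k Y => flow (H k) (z 0 k) Y) X s.

Lemma flow_joint_flow k t s z X :
  flow (H k) t (joint_flow s z X) = joint_flow s z (flow (H k) t X).
Proof.
elim: s => //= l s <-; have [[I [J kM]] [I' [J' lM]]] := (HM k, HM l).
exact: (flow_commute _ _ _ kM lM (HH k l)).
Qed.

Lemma joint_flow0 s X : joint_flow s 0 X = X.
Proof. by elim: s => //= k s ->; rewrite mxE flow0. Qed.

(** After splitting the time of the outermost flow, its [w] part is moved inward past the remaining
    [z] flows. *)
Lemma joint_flowD s z w X :
  joint_flow s (z + w) X = joint_flow s z (joint_flow s w X).
Proof.
elim: s => [|k s IH]; first exact: (erefl X).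
rewrite /= IH; have [I [J kM]] := HM k.
have -> : (z + w) 0 k = w 0 k + z 0 k by rewrite mxE addrC.
rewrite (flow_add kM).
by rewrite (flow_joint_flow k (w 0 k) s z (joint_flow s w X)).
Qed.

Lemma joint_flow_coord s k t X : uniq s ->
  joint_flow s (t *: delta_mx 0 k) X = if k \in s then flow (H k) t X else X.
Proof.
elim: s => //= l s IH /andP[ls us]; rewrite IH // !mxE eqxx /= inE eq_sym.
case: eqVneq => [->|_]; first by rewrite (negPf ls) mulr1.
by rewrite mulr0 flow0.
Qed.

Lemma differentiable_joint_flow s (p : 'rV[K]_N * M) :
  differentiable (fun q : 'rV[K]_N * M => joint_flow s q.1 q.2) p.
Proof.
elim: s => [|k s IH] /=.
  by apply: (@linear_differentiable _ _ _ snd) => q; exact: cvg_snd.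
have [I [J kM]] := HM k.
apply: (differentiable_flow (minor_polyfun kM)) => //.
apply: (@differentiable_comp _ _ _ _ fst (fun z : 'rV[K]_N => z 0 k : K^o)).
  by apply: (@linear_differentiable _ _ _ fst) => q; exact: cvg_fst.
exact: differentiable_coord.
Qed.

Lemma joint_flow_action : exists phi : 'rV[K]_N -> M -> M,
  analytic_action phi /\ hamiltonian_action H phi.
Proof.
exists (joint_flow (enum 'I_N)); split; split.
- exact: joint_flow0.
- exact: joint_flowD.
- exact: differentiable_joint_flow.
- by move=> k l X; rewrite -poissonE HH.
- move=> k X.
  have -> : (fun t => joint_flow (enum 'I_N) (t *: delta_mx 0 k) X) =
      (fun t => flow (H k) t X).
    by apply/funext => t; rewrite joint_flow_coord ?enum_uniq // mem_enum.
  have [I [J kM]] := HM k.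
  exact: integral_curve_flow kM X.
Qed.

End JointFlow.

(** * The Kogan-Zelevinsky Hamiltonians commute *)

Section KoganZelevinsky.
Variables (R : realType) (n : nat).
Variable js : ((n * n.-1) %/ 2).-tuple 'I_n.-1.

Lemma KZ_minor_like k :
  minor_like (KZ_u js k @: initial_set (tnth js k))
    (KZ_v js k @: initial_set (tnth js k)) (@KZ_hamiltonian R _ _ js k).
Proof. exact: minor_likeP. Qed.

Lemma KZ_u_imset (k : 'I_((n * n.-1) %/ 2)) (A : {set 'I_n}) :
  KZ_u js k @: A = (word_perm js)^-1%g @: (KZ_v js k @: A).
Proof. by rewrite -imset_comp; apply: eq_imset => i; rewrite permM. Qed.

Hypothesis js_reduced : reduced js.

Lemma KZ_commute k l X :
  poisson (@KZ_hamiltonian R _ _ js k) (@KZ_hamiltonian R _ _ js l) X = 0.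
Proof.
wlog kl : k l / (k < l)%N.
  move=> th; have [/th //|/th lk|/val_inj ->] := ltngtP k l.
    by rewrite poissonC lk oppr0.
  exact: poisson_eq0.
apply: (poisson_separated (KZ_minor_like k) (KZ_minor_like l)).
(* The row sets are images of the column sets under the order-reversing [(word_perm js)^-1], so
   column separation turns into row separation in the opposite order. *)
- have imD (w : 'S_n) (A B : {set 'I_n}) x :
      x \in w @: A :\: w @: B -> exists2 a, a \in A :\: B & x = w a.
    rewrite inE => /andP[xB /imsetP[a aA E]]; exists a => //.
    by rewrite inE aA andbT; apply: contra xB => aB; rewrite E imset_f.
  move=> i m; rewrite !KZ_u_imset => /imD[a aJ ->] /imD[b bJ ->].
  apply: (word_perm_decreasing js_reduced).
  exact: KZ_v_separated kl aJ bJ.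
- by move=> i m; apply: KZ_v_separated kl.
- by rewrite !KZ_u_imset -(imsetI (in2W perm_inj)) card_imset //; apply: perm_inj.
Qed.

End KoganZelevinsky.

Theorem corollary3p2 (R : realType) (n : nat) (hn : (2 <= n)%N)
    (js : ((n * n.-1) %/ 2).-tuple 'I_n.-1)
    (hred : reduced js) (hlong : longest (word_perm js)) :
  (forall k : 'I_((n * n.-1) %/ 2), complete_flow (@KZ_hamiltonian R _ _ js k)) /\
  (exists phi : 'rV[Cplx R]_((n * n.-1) %/ 2) -> 'M[Cplx R]_n -> 'M[Cplx R]_n,
     analytic_action phi /\ hamiltonian_action (@KZ_hamiltonian R _ _ js) phi).
Proof.
split=> [k X|].
  exists (fun t => flow (@KZ_hamiltonian R _ _ js k) t X).
  exact: integral_curve_flow (KZ_minor_like R js k) X.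
apply: joint_flow_action => [k|k l X]; last exact: KZ_commute.
by do 2!eexists; apply: KZ_minor_like.
Qed.
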